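(* Let $n>9$ and let $S$ be the blowup of $\mathbb{P}^2$ in $n$ very general points. Then the cone $$\mathrm{Nef}^{\mathrm{e}}(S)_{K_S\le0}:=\{\alpha\in\mathrm{Nef}^{\mathrm{e}}(S)\mid \alpha\cdot K_S\le0\}$$ admits a rational polyhedral fundamental cone with respect to the Cremona action of $W=W_n$, i.e. a rational polyhedral cone which is a fundamental domain for the action of $W_n$ on $\mathrm{Nef}^{\mathrm{e}}(S)_{K_S\le0}$.
   Context: Everything is over $\mathbb{C}$. Very general points: let $P_1,\dots,P_n\in\mathbb{P}^2$ be points, no three of them on a line. Take a standard quadratic (Cremona) transformation of $\mathbb{P}^2$ centered at three of them, say $P_i,P_j,P_k$; this gives a new set of points, consisting of $P_i,P_j,P_k$ and the images of the remaining points. The points $P_1,\dots,P_n$ are very general (in very general position) if, after any finite iteration of this process, the new set of points does not contain three points on a line. Let $S$ be the blowup of $\mathbb{P}^2$ at $n$ such points. $N^1_{\mathbb{R}}(S)=(\mathrm{Pic}(S)/\equiv)\otimes\mathbb{R}$ has basis $e_0,e_1,\dots,e_n$, where $e_0$ is the class of the pullback of a line and $e_i$ is the class of the exceptional divisor over $P_i$; the intersection form satisfies $e_0^2=1$, $e_i^2=-1$ for $i\ge1$, and $e_i\cdot e_j=0$ for $i\ne j$. The canonical class is $K_S=-3e_0+\sum_{i=1}^n e_i$. $\mathrm{Eff}(S)$ is the (not necessarily closed) convex cone of finite nonnegative real combinations of classes of curves in $S$; $\mathrm{Nef}(S)=\{v\in N^1_{\mathbb{R}}(S)\mid v\cdot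 c\ge0\text{ for every curve }c\subset S\}$; $\mathrm{Nef}^{\mathrm{e}}(S)=\mathrm{Nef}(S)\cap\mathrm{Eff}(S)$. Cremona action: for distinct $i,j,k\in\{1,\dots,n\}$ let $\varphi_{ijk}$ be the linear map of $N^1_{\mathbb{R}}(S)$ which fixes $e_l$ for $l\notin\{0,i,j,k\}$ and acts by $e_0\mapsto 2e_0-e_i-e_j-e_k$, $e_i\mapsto e_0-e_j-e_k$, $e_j\mapsto e_0-e_i-e_k$, $e_k\mapsto e_0-e_i-e_j$. The group $W=W_n$ is the subgroup of $\mathrm{GL}(n+1,\mathbb{R})$ generated by all the $\varphi_{ijk}$; it preserves the intersection form, $K_S$, and the cones above. Fundamental domain: if a group $G$ acts faithfully by homeomorphisms on a topological space $T$, a fundamental domain of $T$ with respect to this action is a closed region $R\subset T$ such that $T=\bigcup_{g\in G}gR$ and $R^\circ\cap(gR)^\circ=\emptyset$ for every $g\in G\setminus\{e\}$ (where $^\circ$ denotes interior in $T$). A convex cone is polyhedral if it is generated by finitely many vectors; a polyhedral cone in $N^1_{\mathbb{R}}(S)$ is rational if each of its extremal rays contains a nonzero divisor class of $S$. *)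

(* Defs.v *)
From HB Require Import structures.
From mathcomp Require Import all_boot all_order all_algebra.
From mathcomp Require mpoly.
From mathcomp Require Import complex.
Set Implicit Arguments.
Unset Strict Implicit.
Unset Printing Implicit Defensive.
Import Order.TTheory GRing.Theory Num.Theory.
Local Open Scope ring_scope.

(* A point of P^2 is given by a nonzero vector of homogeneous coordinates,    *)
(* and a plane curve by a form in three variables. This is a module because   *)
(* the notations of mpoly cannot be active together with those of             *)
(* mathcomp-analysis.                                                         *)
Module PlaneCurve.
Import mpoly.
Section PlaneCurve.
Variable F : fieldType.

Definition form_of_degree (d : nat) (f : {mpoly F[3]}) : Prop := f \is d.-homog.

Definition irreducible (f : {mpoly F[3]}) : Prop :=
  [/\ f != 0, f \isn't a GRing.unit &
      forall g h : {mpoly F[3]}, f = g * h ->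
        g \is a GRing.unit \/ h \is a GRing.unit].

Definition translate (f : {mpoly F[3]}) (p : 'cV[F]_3) : {mpoly F[3]} :=
  f \mPo [tuple 'X_i + (p i 0)%:MP | i < 3].

(* The order of vanishing at p of f <> 0, that is, the least degree of a      *)
(* monomial of f(p + X). As the affine cone over a plane curve is, near       *)
(* p <> 0, the product of the curve and a line, this is the multiplicity of   *)
(* the curve f = 0 at the point [p]; it does not depend on the choice of p.   *)
(* Every monomial has degree less than msize, so the default is never reached.*)
Definition multiplicity (f : {mpoly F[3]}) (p : 'cV[F]_3) : nat :=
  let g := translate f p in \big[minn/msize g]_(m <- msupp g) mdeg m.

End PlaneCurve.
End PlaneCurve.

From mathcomp Require Import all_classical all_reals all_analysis.
Import numFieldNormedType.Exports.
Local Open Scope classical_set_scope.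

Section VeryGeneral.
Variables (F : fieldType) (n : nat).
Implicit Types P Q : 'I_n -> 'cV[F]_3.

Definition proj_eq (p q : 'cV[F]_3) : Prop := exists2 c : F, c != 0 & q = c *: p.

Definition collinear (p q r : 'cV[F]_3) : Prop :=
  exists2 l : 'rV[F]_3, l != 0 & [/\ l *m p = 0, l *m q = 0 & l *m r = 0].

Definition no_three_collinear P : Prop :=
  forall i j k, i != j -> i != k -> j != k -> ~ collinear (P i) (P j) (P k).

(* [x : y : z] |-> [yz : xz : xy] *)
Definition std_quadratic (v : 'cV[F]_3) : 'cV[F]_3 :=
  \col_i \prod_(j | j != i) v j 0.

(* If the columns of A represent three points, the quadratic transformations  *)
(* centered at these points which have them as base points of their inverse   *)
(* are the conjugates of std_quadratic by such matrices A.                    *)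
Definition quadratic_map (A : 'M[F]_3) (v : 'cV[F]_3) : 'cV[F]_3 :=
  A *m std_quadratic (invmx A *m v).

Definition cremona_points (A : 'M[F]_3) (i j k : 'I_n) P : 'I_n -> 'cV[F]_3 :=
  fun l => if l \in [:: i; j; k] then P l else quadratic_map A (P l).

Inductive cremona_iterate P : ('I_n -> 'cV[F]_3) -> Prop :=
| cremona_iterate0 : cremona_iterate P P
| cremona_iterateS Q (i j k : 'I_n) (A : 'M[F]_3) :
    cremona_iterate P Q ->
    i != j -> i != k -> j != k ->
    A \in unitmx ->
    proj_eq (Q i) (col 0 A) -> proj_eq (Q j) (col 1 A) ->
    proj_eq (Q k) (col 2%:R A) ->
    cremona_iterate P (cremona_points A i j k Q).

Definition very_general P : Prop :=
  forall Q, cremona_iterate P Q -> no_three_collinear Q.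

End VeryGeneral.

Section Cones.
Variables (R : realType) (m : nat).
Local Notation V := 'cV[R]_m.
Implicit Types (C X : set V) (v : V).

Definition cone_hull X : set V :=
  [set v | exists (k : nat) (a : 'I_k -> R) (x : 'I_k -> V),
     [/\ forall i, 0 <= a i, forall i, X (x i) & v = \sum_i a i *: x i]].

Definition polyhedral_cone C : Prop :=
  exists s : seq V, C = cone_hull [set v | v \in s].

Definition ray v : set V := [set t *: v | t in [set t : R | 0 <= t]].

Definition extremal_ray C v : Prop :=
  [/\ v != 0, ray v `<=` C &
      forall x y, C x -> C y -> ray v (x + y) -> ray v x /\ ray v y].

Definition rational_polyhedral_cone C : Prop :=
  polyhedral_cone C /\
  forall v, extremal_ray C v ->
    exists2 z : 'cV[int]_m, z != 0 & ray v (map_mx intr z).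

End Cones.

Section FundamentalDomain.
Variables (R : realType) (m : nat).
Local Notation V := 'cV[R]_m.+1.
Implicit Types (G : set 'M[R]_m.+1) (T D : set V).

Inductive generated_subgroup G : set 'M[R]_m.+1 :=
| gen_one : generated_subgroup G 1
| gen_gen g : G g -> generated_subgroup G g
| gen_mul g h : generated_subgroup G g -> generated_subgroup G h ->
    generated_subgroup G (g * h)
| gen_inv g : generated_subgroup G g -> generated_subgroup G g^-1.

Definition translate_set (g : 'M[R]_m.+1) (D : set V) : set V := [set g *m v | v in D].

(* As G is a group, continuity of all its elements makes them homeomorphisms. *)
Definition acts_faithfully_by_homeo G T : Prop :=
  [/\ forall g, G g -> translate_set g T = T,
      forall g, G g -> {within T, continuous (fun v : V => g *m v)} &
      forall g, G g -> (forall v, T v -> g *m v = v) -> g = 1].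

(* The topology of subspace T induces on T the subspace topology (and makes   *)
(* the points outside T isolated), so for a subset D of T, being closed and   *)
(* taking the interior in subspace T have the same meaning as in T.           *)
Definition interior_in T D : set V := interior (D : set (subspace T)).

Definition fundamental_domain G T D : Prop :=
  [/\ acts_faithfully_by_homeo G T,
      D `<=` T /\ closed (D : set (subspace T)),
      T = \bigcup_(g in G) translate_set g D &
      forall g, G g -> g != 1 ->
        interior_in T D `&` interior_in T (translate_set g D) = set0].

End FundamentalDomain.

(* The blowup S of P^2 at points P_0, ..., P_{n-1}: N^1(S) is the space of    *)
(* column vectors in the basis e_0, ..., e_n, and exc i is the class of the   *)
(* exceptional divisor over the point P_i.                                    *)
Section Blowup.
Variables (R : realType) (n : nat).
Local Notation N1 := 'cV[R]_n.+1.
Implicit Types (P : 'I_n -> 'cV[R[i]]_3) (v w : N1).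

Definition line_class : N1 := delta_mx 0 0.
Definition exc (i : 'I_n) : N1 := delta_mx (lift ord0 i) 0.

Definition intersection v w : R :=
  v 0 0 * w 0 0 - \sum_(i < n) v (lift ord0 i) 0 * w (lift ord0 i) 0.

Definition canonical_class : N1 := - (3%:R *: line_class) + \sum_(i < n) exc i.

(* The integral curves of S are the exceptional curves and the strict         *)
(* transforms of the integral plane curves; the strict transform of a curve   *)
(* of degree d with multiplicity m_i at P_i has class                         *)
(* d e_0 - \sum_i m_i e_i.                                                    *)
Inductive curve_class P : set N1 :=
| exceptional_curve (i : 'I_n) : curve_class P (exc i)
| strict_transform d f :
    PlaneCurve.form_of_degree d f -> PlaneCurve.irreducible f ->
    curve_class P
      (d%:R *: line_class
       - \sum_(i < n) (PlaneCurve.multiplicity f (P i))%:R *: exc i).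

Definition Eff P : set N1 := cone_hull (curve_class P).
Definition Nef P : set N1 :=
  [set v | forall c, curve_class P c -> 0 <= intersection v c].
Definition Nef_e P : set N1 := Nef P `&` Eff P.

Definition Nef_e_Kle0 P : set N1 :=
  [set v | Nef_e P v /\ intersection v canonical_class <= 0].

Definition cremona_image (i j k : 'I_n) (l : 'I_n.+1) : N1 :=
  if l == ord0 then 2%:R *: line_class - exc i - exc j - exc k
  else if l == lift ord0 i then line_class - exc j - exc k
  else if l == lift ord0 j then line_class - exc i - exc k
  else if l == lift ord0 k then line_class - exc i - exc j
  else delta_mx l 0.

(* The matrix of phi_ijk, acting on column vectors on the left. *)
Definition cremona_mx (i j k : 'I_n) : 'M[R]_n.+1 :=
  \matrix_(a, l) cremona_image i j k l a 0.

Definition cremona_group : set 'M[R]_n.+1 :=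
  generated_subgroup
    [set g | exists i j k : 'I_n,
       [/\ i != j, i != k, j != k & g = cremona_mx i j k]].

End Blowup.

(* Main.v *)
Require Import Defs.
From HB Require Import structures.
From mathcomp Require Import all_boot all_order all_algebra complex.
From mathcomp Require mpoly boolp.
From mathcomp Require Import zify ring lra.
Set Implicit Arguments.
Unset Strict Implicit.
Unset Printing Implicit Defensive.
Import Order.TTheory GRing.Theory Num.Theory.
Local Open Scope ring_scope.

(** Let W act on N^1(S), let K be the canonical class, and write the classes as
    d h - sum_i m_i e_i, where h is the class of a line. The group W is generated
    by the reflections in the simple roots h - e_0 - e_1 - e_2 and e_i - e_(i+1):
    its generators are the reflections in h - e_i - e_j - e_k, and they generate
    the transpositions of the e_i. The fundamental domain is the cone D, called
    chamber below, of the classes that are nonnegative on the simple roots and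
    on the e_i and satisfy v.K <= 0.

    Geometry enters through two facts. First, a quadratic transformation maps
    the curves of the blowup at the P_i to curves of the blowup at the transformed
    points, which are again very general. Hence an element of W maps the curves
    of S to curves of another such surface, and their images have nonnegative
    degree and, unless they are exceptional, nonnegative multiplicities. This is
    forward, which rests on cremona_curve. Second, counting parameters,
    an integral class v with d >= 0 and v.K <= v.v is effective. This is
    integral_Eff, which rests on form_with_multiplicities.

    D is nef (chamber_nef): reflecting a curve in a simple root that it meets
    negatively does not increase its intersection with a class of D, and it
    decreases its intersection with the fixed strictly dominant class rho, which
    is a nonnegative integer. So one may assume that the curve is some e_i or
    has a dominant class, and then Noether's inequality (dominant_dot) applies. The
    same inequality gives v.v >= 0 >= v.K on D. As D is generated by integral
    classes (chamber_cone_hull), the translates of D are effective; they are nef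
    because W maps curves to curves. Conversely, an effective class is a nonnegative
    combination of curves, so its intersection with rho attains a minimum on
    its W-orbit, and at a minimum the class is dominant (Nef_e_chamber).

    Finally let x and y be in D, x positive on all simple roots, and x = g y. On the
    (-1)-curves in the orbit of the e_i, the function x successively attains
    its least values at e_(n-1), ..., e_2, and nowhere else; as y has the same minima,
    g fixes these classes. On the plane blown up at two points that is left, g can
    only be the identity (chamber_free). The classes in the interior of D are positive
    on all simple roots, because a reflection maps part of every neighborhood
    of a wall out of D (interior_strict). So the interiors of the translates of D are
    disjoint. *)

Module PlaneForms.
Import mpoly.

(** * Orders of vanishing of polynomials *)

Section Order.
Variables (n : nat) (R : idomainType) (mf : measure n).
Implicit Types (f g : {mpoly R[n]}) (m : 'X_{1..n}).

(** For the total degree and f translated to p, this is the multiplicity of f at p;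
    for other weights it measures divisibility by the coordinates. *)
Definition ord f : nat := \big[minn/mmeasure mf f]_(m <- msupp f) mf m.

Lemma bigmin_attained (T : eqType) (s : seq T) (h : T -> nat) (b : nat) :
  (forall x, x \in s -> (h x < b)%N) -> s != [::] ->
  exists2 x, x \in s & h x = \big[minn/b]_(y <- s) h y.
Proof.
elim: s => // x s IHs hb _.
rewrite big_cons; have [->|s0] := eqVneq s [::].
  exists x; rewrite ?mem_head // big_nil.
  by apply/esym/minn_idPl/ltnW/hb; rewrite mem_head.
have [|y ys yE] := IHs _ s0.
  by move=> y ys; apply: hb; rewrite inE ys orbT.
rewrite -yE minnC /minn; case: ifP => _; first by exists y; rewrite ?inE ?ys ?orbT.
by exists x; rewrite ?mem_head.
Qed.

Lemma ord_attained f : f != 0 -> exists2 m, m \in msupp f & mf m = ord f.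
Proof.
move=> f0; apply: bigmin_attained; last by rewrite msupp_eq0.
by move=> m; apply: mmeasure_mnm_lt.
Qed.

Lemma ord_le f m : m \in msupp f -> (ord f <= mf m)%N.
Proof.
rewrite /ord; elim: (msupp f) => // x s IHs; rewrite inE big_cons.
by case/orP => [/eqP ->|/IHs]; lia.
Qed.

Lemma ord_ge f k : f != 0 -> (forall m, m \in msupp f -> (k <= mf m)%N) ->
  (k <= ord f)%N.
Proof. by move=> /ord_attained [m ms <-]; apply. Qed.

Lemma mcoeff_pihomog d f m :
  (pihomog mf d f)@_m = if mf m == d then f@_m else 0.
Proof.
rewrite pihomogE raddf_sum /= -big_filter; case: ifP => md.
  rewrite [in RHS](mpolyE f) raddf_sum /= [RHS](bigID (fun x => mf x == d)) /=.
  rewrite [X in _ = _ + X]big1 ?addr0 ?big_filter // => x xd.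
  rewrite mcoeffZ mcoeffX; case: eqP => [xm|]; last by rewrite mulr0.
  by rewrite xm md in xd.
rewrite big_filter big1 // => x xd; rewrite mcoeffZ mcoeffX.
by case: eqP => [xm|]; [rewrite -xm xd in md | rewrite mulr0].
Qed.

(** The components of lowest weight multiply to a nonzero component, since
    there are no zero divisors. *)
Lemma ordM f g : f != 0 -> g != 0 -> ord (f * g) = (ord f + ord g)%N.
Proof.
move=> f0 g0; apply/eqP; rewrite eqn_leq; apply/andP; split; last first.
  apply: ord_ge => [|m]; first by rewrite mulf_neq0.
  case/msuppM_le/allpairsP => -[m1 m2] /= [h1 h2 ->].
  by rewrite mfD leq_add // ord_le.
set k := ord f; set l := ord g.
have pi0 h : h != 0 -> pihomog mf (ord h) h != 0.
  move=> h0; have [m ms me] := ord_attained h0.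
  apply: contraTneq ms => e; rewrite mcoeff_msupp negbK.
  by have := mcoeff_pihomog (ord h) h m; rewrite e me eqxx mcoeff0 => <-.
pose fa := pihomog mf k f; pose gb := pihomog mf l g.
have : fa * gb != 0 by rewrite mulf_neq0 ?pi0.
rewrite -msupp_eq0; case E: (msupp _) => [//|m s] _.
have ms : m \in msupp (fa * gb) by rewrite E mem_head.
have mE : mf m = (k + l)%N.
  have /dhomogP/(_ _ ms) // : fa * gb \is (k + l).-homog for mf.
  by apply: dhomogM; apply: pihomogP.
have hi h m' : m' \in msupp (h - pihomog mf (ord h) h) -> (ord h < mf m')%N.
  rewrite mcoeff_msupp mcoeffB mcoeff_pihomog.
  case: (mf m' =P ord h) => [_|ne]; first by rewrite subrr eqxx.
  by rewrite subr0 -mcoeff_msupp => /ord_le; move: ne; lia.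
rewrite -mE; apply: ord_le; rewrite mcoeff_msupp.
have -> : f * g = fa * gb + (fa * (g - gb) + (f - fa) * g) by rewrite /=; ring.
rewrite mcoeffD [X in _ + X](_ : _ = 0) ?addr0 -?mcoeff_msupp //.
apply/eqP; rewrite -[_ == _]negbK -mcoeff_msupp; apply/negP.
move/msuppD_le; rewrite mem_cat => /orP[].
  case/msuppM_le/allpairsP => -[m1 m2] /= [h1 /hi h2 me].
  have /dhomogP/(_ _ h1) m1a : fa \is k.-homog for mf by apply: pihomogP.
  by move: mE; rewrite me mfD m1a; lia.
case/msuppM_le/allpairsP => -[m1 m2] /= [/hi h1 /ord_le h2 me].
by move: mE; rewrite me mfD; lia.
Qed.

Lemma ordC c : ord c%:MP = 0%N.
Proof.
rewrite /ord msuppC mmeasureC; case: (c == 0) => /=; first by rewrite big_nil.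
by rewrite big_cons big_nil mf0.
Qed.

Lemma ordZ c f : c != 0 -> ord (c *: f) = ord f.
Proof.
move=> c0; have [->|f0] := eqVneq f 0; first by rewrite scaler0.
by rewrite -mul_mpolyC ordM ?mpolyC_eq0 // ordC.
Qed.

Lemma ordX m : ord 'X_[m] = mf m.
Proof. by rewrite /ord msuppX big_cons big_nil mmeasureX; apply/minn_idPl. Qed.

Lemma mpolyX_neq0 m : 'X_[R, m] != 0.
Proof. by rewrite -msupp_eq0 msuppX. Qed.

Lemma ordMX f m : f != 0 -> ord ('X_[m] * f) = (mf m + ord f)%N.
Proof. by move=> f0; rewrite ordM ?mpolyX_neq0 // ordX. Qed.

Lemma ord_homog d f : f != 0 -> f \is d.-homog for mf -> ord f = d.
Proof. by move=> /ord_attained [m ms <-] /dhomogP/(_ _ ms). Qed.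

End Order.

Section Factors.
Variables (n : nat) (R : idomainType).
Implicit Types (f g h : {mpoly R[n]}).

(** Both the lowest and the highest degree are additive, so they agree on the
    factors as soon as they agree on the product. *)
Lemma homog_factor d g h : g * h != 0 -> g * h \is d.-homog ->
  exists k l, [/\ g \is k.-homog, h \is l.-homog & d = (k + l)%N].
Proof.
rewrite mulf_eq0 negb_or => /andP[g0 h0] gh.
have hle (f : {mpoly R[n]}) : f != 0 -> (ord mdeg f <= (msize f).-1)%N.
  move=> /(ord_attained mdeg) [m ms <-] /=; have := msize_mdeg_lt ms.
  by case: (msize f).
have hom (f : {mpoly R[n]}) : f != 0 -> ord mdeg f = (msize f).-1 ->
    f \is (msize f).-1.-homog.
  move=> f0 fo; apply/dhomogP => m ms.
  by have := msize_mdeg_lt ms; have := ord_le mdeg ms; rewrite fo /=; lia.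
have e1 := ordM mdeg g0 h0.
have e2 := msizeM g0 h0.
have gh0 : g * h != 0 by rewrite mulf_neq0.
have e3 := ord_homog gh0 gh.
have e4 : (msize (g * h)).-1 = d.
  by apply: dhomog_uniq gh0 (dhomog_msize gh) gh.
have sz0 (f : {mpoly R[n]}) : f != 0 -> (0 < msize f)%N.
  by move=> f0; rewrite lt0n msize_poly_eq0.
have := hle _ g0; have := hle _ h0; have := sz0 _ g0; have := sz0 _ h0.
move=> sh sg lh lg; exists (msize g).-1, (msize h).-1.
by split; [apply: hom => // | apply: hom => // | ]; lia.
Qed.

Lemma unit_homog f : f != 0 -> f \is 0.-homog -> exists2 c, c != 0 & f = c%:MP.
Proof.
move=> f0 /dhomogP fh; apply/msize_poly1P; rewrite eqn_leq lt0n msize_poly_eq0 f0.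
rewrite andbT msizeE; apply/bigmax_leqP_seq => m /fh /= -> //.
Qed.

End Factors.

Section Substitution.
Variables (n : nat) (R : idomainType).
Implicit Types (f g h : {mpoly R[n]}).

Lemma comp_mpolyA f (t s : n.-tuple {mpoly R[n]}) :
  (f \mPo t) \mPo s = f \mPo [tuple tnth t i \mPo s | i < n].
Proof.
rewrite [f \mPo t]comp_mpolyE raddf_sum [RHS]comp_mpolyE; apply: eq_bigr => m _.
rewrite /= comp_mpolyZ rmorph_prod; congr (_ *: _); apply: eq_bigr => i _.
by rewrite rmorphXn tnth_mktuple.
Qed.

(** Lower bounds, upper bounds and exact values for the degrees of the monomials
    of f are propagated through sums and products in the same way. *)
Definition degrees (r : rel nat) (k : nat) f :=
  forall m, m \in msupp f -> r k (mdeg m).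

Definition additive_rel (r : rel nat) :=
  r 0 0 /\ forall a b c d, r a b -> r c d -> r (a + c)%N (b + d)%N.

Section Degrees.
Variable r : rel nat.
Hypothesis rD : additive_rel r.

Lemma degrees_add k f g : degrees r k f -> degrees r k g -> degrees r k (f + g).
Proof. by move=> hf hg m /msuppD_le; rewrite mem_cat => /orP[/hf|/hg]. Qed.

Lemma degreesZ k c f : degrees r k f -> degrees r k (c *: f).
Proof. by move=> hf m /msuppZ_le /hf. Qed.

Lemma degreesM k l f g : degrees r k f -> degrees r l g -> degrees r (k + l) (f * g).
Proof.
move=> hf hg m /msuppM_le/allpairsP [[m1 m2] /= [/hf h1 /hg h2 ->]].
by rewrite mdegD; apply: rD.2.
Qed.

Lemma degrees1 : degrees r 0 1.
Proof. by move=> m; rewrite msupp1 inE => /eqP ->; rewrite mdeg0 rD.1. Qed.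

Lemma degreesX k l f : degrees r l f -> degrees r (l * k) (f ^+ k).
Proof.
move=> hf; elim: k => [|k IHk]; first by rewrite muln0; apply: degrees1.
by rewrite exprS mulnS; apply: degreesM.
Qed.

Lemma degrees_prod (I : finType) (k : I -> nat) (F : I -> {mpoly R[n]}) :
  (forall i, degrees r (k i) (F i)) -> degrees r (\sum_i k i) (\prod_i F i).
Proof.
move=> h; elim/big_rec2: _ => [|i l g _ hg]; first exact: degrees1.
exact: degreesM.
Qed.

Lemma degrees_sum k (I : eqType) (s : seq I) (F : I -> {mpoly R[n]}) :
  (forall i, i \in s -> degrees r k (F i)) -> degrees r k (\sum_(i <- s) F i).
Proof.
elim: s => [|i s IHs] h; first by rewrite big_nil => m; rewrite msupp0.
rewrite big_cons; apply: degrees_add; first by apply: h; rewrite mem_head.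
by apply: IHs => j js; apply: h; rewrite inE js orbT.
Qed.

Lemma degrees_comp f (t : n.-tuple {mpoly R[n]}) k l :
  (forall i, degrees r l (tnth t i)) ->
  (forall m x, m \in msupp f -> r (l * mdeg m)%N x -> r (l * k)%N x) ->
  degrees r (l * k) (f \mPo t).
Proof.
move=> ht hk; rewrite comp_mpolyE; apply: degrees_sum => m ms.
apply: degreesZ => m' m's; apply: (hk m) => //; move: m' m's.
rewrite mdegE big_distrr /=.
by apply: degrees_prod => i; apply: degreesX.
Qed.

End Degrees.

Lemma ord_comp_ge f (t : n.-tuple {mpoly R[n]}) :
  (forall i, (tnth t i)@_0 = 0) -> f \mPo t != 0 ->
  (ord mdeg f <= ord mdeg (f \mPo t))%N.
Proof.
move=> t0 ft0; apply: ord_ge => //; rewrite -[ord _ _]mul1n.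
apply: (@degrees_comp leq) => [||m x ms]; first by split=> // *; apply: leq_add.
  move=> i m; rewrite mcoeff_msupp lt0n mdeg_eq0.
  by apply: contraNneq => ->; rewrite t0.
by rewrite !mul1n; apply: leq_trans; apply: (ord_le mdeg).
Qed.

Lemma homog_comp d e f (t : n.-tuple {mpoly R[n]}) :
  f \is d.-homog -> (forall i, tnth t i \is e.-homog) ->
  f \mPo t \is (e * d).-homog.
Proof.
move=> /dhomogP fd te; apply/dhomogP => m ms; apply/esym/eqP; move: m ms.
apply: (@degrees_comp (@eq_op nat)) => [||m x /fd /= ->]; last by [].
  by split=> // a b c k /eqP -> /eqP ->.
by move=> i m; have /dhomogP h := te i; move=> /h /= ->.
Qed.

End Substitution.

(** * Multiplicities of plane curves and changes of coordinates *)

Section Multiplicity.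
Variable F : fieldType.
Implicit Types (f g h : {mpoly F[3]}) (p q : 'cV[F]_3) (A : 'M[F]_3).
Implicit Types (t : 3.-tuple {mpoly F[3]}).
Local Notation mult := PlaneCurve.multiplicity.
Local Notation translate := PlaneCurve.translate.

Lemma multE f p : mult f p = ord mdeg (translate f p).
Proof. by []. Qed.

Lemma translateM f g p : translate (f * g) p = translate f p * translate g p.
Proof. exact: rmorphM. Qed.

Lemma translateK f p : translate (translate f p) (- p) = f.
Proof.
rewrite /translate comp_mpolyA -[RHS]comp_mpoly_id; congr (_ \mPo _).
apply: eq_from_tnth => i; rewrite !tnth_mktuple raddfD /= comp_mpolyC.
by rewrite comp_mpolyXU -tnth_nth tnth_mktuple mxE mpolyCN subrK.
Qed.

Lemma translate_neq0 f p : f != 0 -> translate f p != 0.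
Proof.
apply: contraNneq => f0; rewrite -(translateK f p) f0.
by rewrite /translate comp_mpoly0.
Qed.

Lemma multM f g p : f != 0 -> g != 0 -> mult (f * g) p = (mult f p + mult g p)%N.
Proof. by move=> f0 g0; rewrite !multE translateM ordM ?translate_neq0. Qed.

Definition eval_tuple t p : 'cV[F]_3 := \col_i (tnth t i).@[fun j => p j 0].

Lemma mcoeff0_translate f p : (translate f p)@_0 = f.@[fun i => p i 0].
Proof.
rewrite /translate comp_mpolyE raddf_sum mevalE; apply: eq_bigr => m _ /=.
rewrite mcoeffZ rmorph_prod; congr (_ * _); apply: eq_bigr => i _.
by rewrite rmorphXn /= tnth_mktuple mcoeffD mpolyCK mcoeffX mnm1_eq0 add0r.
Qed.

Lemma translate_comp f t q : translate (f \mPo t) q =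
  translate f (eval_tuple t q) \mPo
    [tuple translate (tnth t i) q - (eval_tuple t q i 0)%:MP | i < 3].
Proof.
rewrite [LHS]comp_mpolyA [RHS]comp_mpolyA.
apply: (congr1 (fun u => f \mPo u)).
apply: eq_from_tnth => i; rewrite !tnth_mktuple comp_mpolyD comp_mpolyC.
by rewrite comp_mpolyXU -tnth_nth tnth_mktuple subrK.
Qed.

(** Substituting a polynomial map that sends q to p replaces the local
    coordinates at p by functions vanishing at q. *)
Lemma mult_comp_ge f t q : f \mPo t != 0 ->
  (mult f (eval_tuple t q) <= mult (f \mPo t) q)%N.
Proof.
move=> ft0; rewrite !multE translate_comp; apply: ord_comp_ge; last first.
  by rewrite -translate_comp translate_neq0.
by move=> i; rewrite tnth_mktuple mcoeffB mcoeff0_translate mpolyCK mxE subrr.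
Qed.

(** Translation does not raise the degree, so some monomial of degree at most d
    survives. *)
Lemma mult_le_deg d f p : f != 0 -> f \is d.-homog -> (mult f p <= d)%N.
Proof.
rewrite multE => f0 /dhomogP fd; have [m ms <-] := ord_attained mdeg (translate_neq0 p f0).
rewrite -[d]mul1n; move: m ms.
apply: (@degrees_comp _ _ geq) => [||m x /fd /= -> //].
  by split=> // a b c e; apply: leq_add.
move=> i m; rewrite tnth_mktuple => /msuppD_le; rewrite mem_cat msuppX inE.
case/orP => [/eqP -> | ]; first by rewrite /= mdeg1.
by rewrite msuppC; case: ifP => // _; rewrite inE => /eqP ->; rewrite /= mdeg0.
Qed.

Lemma mult_eq0 f p : f != 0 -> (mult f p == 0%N) = (f.@[fun i => p i 0] != 0).
Proof.
move=> f0; rewrite -mcoeff0_translate -mcoeff_msupp multE.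
apply/eqP/idP => [e|/(ord_le mdeg)]; last by rewrite /= mdeg0; case: ord.
have [m ms] := ord_attained mdeg (translate_neq0 p f0).
by rewrite e => /eqP; rewrite /= mdeg_eq0 => /eqP <-.
Qed.

End Multiplicity.

Section Coordinates.
Variable F : fieldType.
Implicit Types (f g h : {mpoly F[3]}) (p q : 'cV[F]_3) (A B : 'M[F]_3).
Local Notation mult := PlaneCurve.multiplicity.
Local Notation translate := PlaneCurve.translate.
Local Notation irreducible := PlaneCurve.irreducible.

Lemma homog_unit d f : f != 0 -> f \is d.-homog -> (f \is a GRing.unit) = (d == 0%N).
Proof.
move=> f0 fd; apply/idP/eqP => [fu|d0].
  have /andP[/eqP fE _] : f \in @mpoly_unit 3 F by [].
  apply: (dhomog_uniq f0 fd); rewrite fE -[_%:MP]mulr1 mul_mpolyC.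
  by rewrite dhomogZ // dhomog1.
rewrite d0 in fd; have [c c0 ->] := unit_homog f0 fd.
by rewrite rmorph_unit // unitfE.
Qed.

Lemma unit_const f : f \is a GRing.unit -> exists2 c, c != 0 & f = c%:MP.
Proof.
move=> fu; have /andP[/eqP fE f0u] : f \in @mpoly_unit 3 F by [].
by exists f@_0; rewrite // -unitfE.
Qed.

(** One of two factors has degree zero. *)
Lemma homog1_irreducible f : f != 0 -> f \is 1.-homog -> irreducible f.
Proof.
move=> f0 f1; split=> // [|g h fE]; first by rewrite (homog_unit f0 f1).
have gh0 : g * h != 0 by rewrite -fE.
have gh1 : g * h \is 1.-homog by rewrite -fE.
have [k [l [gk hl]]] := homog_factor gh0 gh1.
move: gh0; rewrite mulf_eq0 negb_or => /andP[g0 h0].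
by rewrite (homog_unit g0 gk) (homog_unit h0 hl); case: k {gk} => [|[]]; lia.
Qed.

Definition lin_tuple A : 3.-tuple {mpoly F[3]} :=
  [tuple \sum_j A i j *: 'X_j | i < 3].
Definition change f A := f \mPo lin_tuple A.

Lemma change_mul f A B : change (change f A) B = change f (A *m B).
Proof.
rewrite /change comp_mpolyA; congr (_ \mPo _).
apply: eq_from_tnth => i; rewrite !tnth_mktuple raddf_sum /=.
transitivity (\sum_j \sum_k (A i j * B j k) *: 'X_k : {mpoly F[3]}).
  apply: eq_bigr => j _; rewrite comp_mpolyZ comp_mpolyXU -tnth_nth tnth_mktuple.
  by rewrite scaler_sumr; apply: eq_bigr => k _; rewrite scalerA.
rewrite exchange_big; apply: eq_bigr => k _.
by rewrite mxE scaler_suml.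
Qed.

Lemma change1 f : change f 1%:M = f.
Proof.
rewrite /change -[RHS]comp_mpoly_id; congr (_ \mPo _).
apply: eq_from_tnth => i; rewrite !tnth_mktuple (bigD1 i) //= mxE eqxx scale1r.
by rewrite big1 ?addr0 // => j ji; rewrite mxE eq_sym (negPf ji) scale0r.
Qed.

Lemma changeK f A : A \in unitmx -> change (change f A) (invmx A) = f.
Proof. by move=> Au; rewrite change_mul mulmxV // change1. Qed.

Lemma changeVK f A : A \in unitmx -> change (change f (invmx A)) A = f.
Proof. by move=> Au; rewrite change_mul mulVmx // change1. Qed.

Lemma change_neq0 f A : A \in unitmx -> f != 0 -> change f A != 0.
Proof.
move=> Au; apply: contraNneq => f0; rewrite -(changeK f Au) f0.
by rewrite /change comp_mpoly0.
Qed.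

Lemma lin_form_homog (a : 'I_3 -> F) : \sum_j a j *: 'X_j \is 1.-homog.
Proof. by rewrite rpred_sum // => j _; rewrite dhomogZ // dhomogX /= mdeg1. Qed.

Lemma change_homog d f A : f \is d.-homog -> change f A \is d.-homog.
Proof.
move=> fd; rewrite -[d]mul1n; apply: homog_comp => // i.
by rewrite tnth_mktuple lin_form_homog.
Qed.

Lemma meval_lin_form (a : 'I_3 -> F) (v : 'I_3 -> F) :
  (\sum_j a j *: 'X_j).@[v] = \sum_j a j * v j.
Proof. by rewrite raddf_sum; apply: eq_bigr => j _ /=; rewrite mevalZ mevalXU. Qed.

Lemma eval_lin_tuple A p : eval_tuple (lin_tuple A) p = A *m p.
Proof.
by apply/colP => i; rewrite !mxE tnth_mktuple meval_lin_form.
Qed.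

Lemma mult_change_ge f A p : A \in unitmx -> f != 0 ->
  (mult f (A *m p) <= mult (change f A) p)%N.
Proof.
by move=> Au f0; rewrite -eval_lin_tuple; apply: mult_comp_ge; apply: change_neq0.
Qed.

(** Both inequalities are instances of mult_comp_ge, as A is invertible. *)
Lemma mult_change f A p : A \in unitmx -> f != 0 ->
  mult (change f A) p = mult f (A *m p).
Proof.
move=> Au f0; apply/eqP; rewrite eqn_leq mult_change_ge // andbT.
have := @mult_change_ge (change f A) (invmx A) (A *m p).
by rewrite unitmx_inv changeK // mulKmx // => -> //; apply: change_neq0.
Qed.

Lemma change_unit f A : f \is a GRing.unit -> change f A \is a GRing.unit.
Proof. exact: rmorph_unit. Qed.

Lemma changeM f g A : change (f * g) A = change f A * change g A.
Proof. exact: rmorphM. Qed.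

Lemma irreducible_change f A : A \in unitmx -> irreducible f -> irreducible (change f A).
Proof.
move=> Au [f0 fu fi]; split; first exact: change_neq0.
  by apply: contraNN fu => /(change_unit (invmx A)); rewrite changeK.
move=> g h E; have [] := fi (change g (invmx A)) (change h (invmx A)).
- by rewrite -changeM -E changeK.
- by move/(change_unit A); rewrite changeVK //; left.
- by move/(change_unit A); rewrite changeVK //; right.
Qed.

Lemma multC c p : mult c%:MP p = 0%N.
Proof. by rewrite multE /PlaneCurve.translate comp_mpolyC ordC. Qed.

Lemma multZ c f p : c != 0 -> mult (c *: f) p = mult f p.
Proof. by move=> c0; rewrite !multE /PlaneCurve.translate comp_mpolyZ ordZ. Qed.

Lemma change_scalar c d f : f \is d.-homog -> change f c%:M = c ^+ d *: f.
Proof.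
move=> /dhomogP fd; rewrite /change comp_mpolyE [in RHS](mpolyE f) scaler_sumr.
apply: eq_big_seq => m /fd /= md; rewrite scalerA mulrC -scalerA; congr (_ *: _).
rewrite mpolyXE_id -md mdegE -prodrXr -scaler_prod; apply: eq_bigr => i _.
rewrite tnth_mktuple -exprZn (bigD1 i) //= big1 ?addr0 ?mxE ?eqxx // => j ji.
by rewrite mxE eq_sym (negPf ji) scale0r.
Qed.

(** A homothety multiplies a form by a constant. *)
Lemma mult_scale c d f p : c != 0 -> f != 0 -> f \is d.-homog ->
  mult f (c *: p) = mult f p.
Proof.
move=> c0 f0 fd; rewrite -mul_scalar_mx -mult_change ?(change_scalar c fd) //.
  by rewrite multZ // expf_neq0.
by rewrite unitmxE det_scalar unitfE expf_neq0.
Qed.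

Definition line (l : 'rV[F]_3) : {mpoly F[3]} := \sum_j l 0 j *: 'X_j.

Lemma line_neq0 l : l != 0 -> line l != 0.
Proof.
apply: contraNneq => l0; apply/eqP/rowP => j; rewrite mxE.
have := congr1 (mcoeff U_(j)) l0; rewrite mcoeff0 raddf_sum /= => <-.
rewrite (bigD1 j) //= mcoeffZ mcoeffXU eqxx mulr1 big1 ?addr0 // => k kj.
by rewrite mcoeffZ mcoeffXU (negPf kj) mulr0.
Qed.

Lemma mult_line l p : l != 0 -> mult (line l) p = (l *m p == 0).
Proof.
move=> l0; have h := line_neq0 l0.
have := mult_le_deg p h (lin_form_homog _); have := mult_eq0 p h.
rewrite /line meval_lin_form -/(line l) => e le1.
have -> : (l *m p == 0) = (\sum_j l 0 j * p j 0 == 0).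
  apply/eqP/eqP => [/matrixP/(_ 0 0)|h0]; first by rewrite !mxE.
  by apply/matrixP => i j; rewrite !ord1 !mxE.
by case: (_ == 0) e le1 => /=; case: (mult _ _) => [|[|]].
Qed.

End Coordinates.

(** * The standard quadratic transformation *)

(** On forms of degree d, wt i m is d - m i: the degree of the monomial m in local
    coordinates at the vertex where only the coordinate i is nonzero, and also
    the exponent of the coordinate i in the quadratic transform of m. *)
Definition wt (i : 'I_3) (m : 'X_{1..3}) : nat := (\sum_(j | j != i) m j)%N.
Definition coord (i : 'I_3) (m : 'X_{1..3}) : nat := m i.

Lemma wt0 i : wt i 0%MM = 0%N.
Proof. by rewrite /wt big1 // => j _; rewrite mnm0E. Qed.
Lemma wtD i : {morph wt i : m1 m2 / (m1 + m2)%MM >-> (m1 + m2)%N}.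
Proof.
by move=> m1 m2; rewrite /wt -big_split; apply: eq_bigr => j _; rewrite mnmDE.
Qed.
HB.instance Definition _ i := isMeasure.Build 3 (wt i) (wt0 i) (@wtD i).

Lemma coord0 i : coord i 0%MM = 0%N.
Proof. exact: mnm0E. Qed.
Lemma coordD i : {morph coord i : m1 m2 / (m1 + m2)%MM >-> (m1 + m2)%N}.
Proof. by move=> m1 m2; rewrite /coord mnmDE. Qed.
HB.instance Definition _ i := isMeasure.Build 3 (coord i) (coord0 i) (@coordD i).

Lemma mdeg_wt i m : mdeg m = (m i + wt i m)%N.
Proof. by rewrite mdegE (bigD1 i). Qed.

Section Quadratic.
Variable F : fieldType.
Implicit Types (f g h : {mpoly F[3]}) (p q : 'cV[F]_3) (A B : 'M[F]_3).
Implicit Types (i j k : 'I_3) (m : 'X_{1..3}).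
Local Notation mult := PlaneCurve.multiplicity.
Local Notation translate := PlaneCurve.translate.
Local Notation irreducible := PlaneCurve.irreducible.

Local Notation vertex i := (delta_mx i 0%R : 'cV[F]_3).

Lemma eq_mnm_wt i m m' : mdeg m = mdeg m' -> (forall j, j != i -> m j = m' j) ->
  m = m'.
Proof.
move=> md h; apply/mnmP => j; have [->|ji] := eqVneq j i; last exact: h.
have : wt i m = wt i m' by apply: eq_bigr.
by have := mdeg_wt i m; have := mdeg_wt i m'; lia.
Qed.

(** The coordinate i becomes a unit at the vertex, and the other two are local
    coordinates there. *)
Lemma mult_coord_ge f i : f != 0 -> (ord (wt i) f <= mult f (vertex i))%N.
Proof.
move=> f0; apply: ord_ge; first exact: translate_neq0.
have rD : additive_rel leq by split=> // *; apply: leq_add.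
suff : degrees leq (ord (wt i) f) (translate f (vertex i)) by [].
rewrite /PlaneCurve.translate comp_mpolyE.
apply: degrees_sum => m ms; apply: degreesZ => m' m's.
apply: leq_trans (ord_le (wt i) ms) _.
suff : degrees leq (wt i m)
    (\prod_(j < 3) tnth [tuple 'X_j + (vertex i j 0)%:MP | j < 3] j ^+ m j) by apply.
rewrite /wt big_mkcond /=.
apply: (degrees_prod rD) => j; rewrite tnth_mktuple.
case: eqVneq => [_|ji] //=; rewrite -[X in degrees _ X]mul1n; apply: (degreesX rD).
move=> m1; rewrite mxE (negPf ji) /= mpolyC0 addr0 msuppX inE => /eqP ->.
by rewrite mdeg1.
Qed.

Definition drop_coord i m : 'X_{1..3} := [multinom (if j == i then 0%N else m j) | j < 3].

Lemma mdeg_drop i m : mdeg (drop_coord i m) = wt i m.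
Proof.
rewrite mdegE /wt [RHS]big_mkcond; apply: eq_bigr => j _.
by rewrite mnmE; case: eqP.
Qed.

(** Setting the remaining local coordinate to zero keeps the monomials of a
    form apart, so the multiplicity is not larger than the weight. *)
Lemma mult_coord d f i : f != 0 -> f \is d.-homog ->
  mult f (vertex i) = ord (wt i) f.
Proof.
move=> f0 /dhomogP fd; apply/eqP; rewrite eqn_leq mult_coord_ge // andbT.
pose s : 3.-tuple {mpoly F[3]} := [tuple (if j == i then 0 else 'X_j) | j < 3].
have E : translate f (vertex i) \mPo s =
    \sum_(m <- msupp f) f@_m *: 'X_[drop_coord i m].
  rewrite /PlaneCurve.translate comp_mpolyA comp_mpolyE; apply: eq_bigr => m _.
  congr (_ *: _); rewrite mpolyXE_id; apply: eq_bigr => j _.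
  rewrite tnth_mktuple mnmE tnth_mktuple comp_mpolyD comp_mpolyXU -tnth_nth.
  rewrite comp_mpolyC tnth_mktuple mxE.
  by case: (j == i); rewrite /= ?add0r ?mpolyC1 ?expr1n ?expr0 // mpolyC0 addr0.
have [m ms mE] := ord_attained (wt i) f0.
have mc : (translate f (vertex i) \mPo s)@_(drop_coord i m) = f@_m.
  rewrite E raddf_sum /= (bigD1_seq m) ?msupp_uniq //= mcoeffZ mcoeffX eqxx mulr1.
  rewrite big_seq_cond big1 ?addr0 // => m' /andP[m's m'm].
  rewrite mcoeffZ mcoeffX; case: eqP => [e|]; last by rewrite mulr0.
  case/eqP: m'm; apply: (@eq_mnm_wt i); first by have := fd _ m's; have := fd _ ms => /= -> ->.
  by move=> j ji; have := congr1 (fun x : 'X_{1..3} => x j) e; rewrite !mnmE (negPf ji).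
have ms' : drop_coord i m \in msupp (translate f (vertex i) \mPo s).
  by rewrite mcoeff_msupp mc -mcoeff_msupp.
rewrite -mE /= -mdeg_drop; apply: leq_trans (ord_le mdeg ms').
rewrite multE; apply: ord_comp_ge; last first.
  by apply: contraTneq ms' => ->; rewrite msupp0.
by move=> j; rewrite tnth_mktuple; case: ifP; rewrite ?mcoeff0 ?mcoeffX ?mnm1_eq0.
Qed.

Definition quad_tuple : 3.-tuple {mpoly F[3]} :=
  [tuple \prod_(j | j != i) 'X_j | i < 3].
Definition quad f := f \mPo quad_tuple.
Definition quad_mnm m : 'X_{1..3} := [multinom wt i m | i < 3].

Lemma quadX m : quad 'X_[m] = 'X_[quad_mnm m].
Proof.
rewrite /quad comp_mpolyX.
transitivity (\prod_(i < 3) \prod_(j < 3 | j != i) ('X_j ^+ m i : {mpoly F[3]})).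
  by apply: eq_bigr => i _; rewrite tnth_mktuple prodrXl.
rewrite [RHS]mpolyXE_id (exchange_big_dep xpredT) //=; apply: eq_bigr => j _.
by rewrite prodrXr mnmE; congr (_ ^+ _); apply: eq_bigl => i; rewrite eq_sym.
Qed.

Lemma mdeg_quad m : mdeg (quad_mnm m) = (2 * mdeg m)%N.
Proof.
have : (mdeg (quad_mnm m) + mdeg m = \sum_(i < 3) mdeg m)%N.
  rewrite mdegE {1}(mdegE m) -big_split; apply: eq_bigr => i _.
  by rewrite mnmE (mdeg_wt i m) addnC.
by rewrite sum_nat_const card_ord; lia.
Qed.

Lemma quad_mnmK m : quad_mnm (quad_mnm m) = [multinom (mdeg m + m i)%N | i < 3].
Proof.
apply/mnmP => i; rewrite !mnmE.
have := mdeg_wt i (quad_mnm m); rewrite mdeg_quad mnmE.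
by have := mdeg_wt i m; lia.
Qed.

Lemma quad_mnm_inj : injective quad_mnm.
Proof.
move=> m m' e; have md : mdeg m = mdeg m'.
  by have := congr1 mdeg e; rewrite !mdeg_quad; lia.
apply/mnmP => i; have := congr1 (fun x : 'X_{1..3} => x i) e; rewrite !mnmE.
by have := mdeg_wt i m; have := mdeg_wt i m'; lia.
Qed.

Lemma quadE f : quad f = \sum_(m <- msupp f) f@_m *: 'X_[quad_mnm m].
Proof.
by rewrite /quad comp_mpolyEX; apply: eq_bigr => m _; rewrite -quadX.
Qed.

Lemma mcoeff_quad f m : (quad f)@_(quad_mnm m) = f@_m.
Proof.
rewrite quadE raddf_sum [in RHS](mpolyE f) raddf_sum; apply: eq_bigr => m' _ /=.
by rewrite !mcoeffZ !mcoeffX (inj_eq quad_mnm_inj).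
Qed.

Lemma quad_neq0 f : f != 0 -> quad f != 0.
Proof.
move=> f0; apply: contraNneq f0 => q0; apply/eqP/mpolyP => m.
by rewrite -mcoeff_quad q0 !mcoeff0.
Qed.

Lemma msupp_quad f m : m \in msupp (quad f) -> exists2 m', m' \in msupp f & m = quad_mnm m'.
Proof.
rewrite quadE => /msupp_sum_le /flattenP [s /mapP [m' m's ->]].
rewrite mem_filter /= in m's => /msuppZ_le; rewrite msuppX inE => /eqP ->.
by exists m'.
Qed.

Lemma ord_quad (mf1 mf2 : measure 3) (k : nat) f : f != 0 ->
  (forall m, m \in msupp f -> mf1 (quad_mnm m) = (k + mf2 m)%N) ->
  ord mf1 (quad f) = (k + ord mf2 f)%N.
Proof.
move=> f0 h; apply/eqP; rewrite eqn_leq; apply/andP; split.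
  have [m ms <-] := ord_attained mf2 f0; rewrite -h //.
  by apply: ord_le; rewrite mcoeff_msupp mcoeff_quad -mcoeff_msupp.
apply: ord_ge; first exact: quad_neq0.
by move=> m /msupp_quad [m' m's ->]; rewrite h // leq_add2l ord_le.
Qed.

Lemma quad_homog d f : f \is d.-homog -> quad f \is (2 * d).-homog.
Proof.
move=> /dhomogP fd; apply/dhomogP => m /msupp_quad [m' /fd /= <- ->].
exact: mdeg_quad.
Qed.

(** The monomial x^a y^b z^c of degree d is mapped to x^(d-a) y^(d-b) z^(d-c), and
    then to x^(d+a) y^(d+b) z^(d+c). *)
Lemma quadK d f : f \is d.-homog ->
  quad (quad f) = 'X_[[multinom d | _ < 3]] * f.
Proof.
move=> /dhomogP fd; rewrite [quad f]quadE {1}/quad raddf_sum /=.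
rewrite [in RHS](mpolyE f) mulr_sumr; apply: eq_big_seq => m /fd /= md.
rewrite comp_mpolyZ -/(quad _) quadX quad_mnmK -scalerAr -mpolyXD.
by congr (_ *: 'X_[_]); apply/mnmP => i; rewrite !mnmE md.
Qed.

Lemma eval_quad_tuple p : eval_tuple quad_tuple p = std_quadratic p.
Proof.
apply/colP => i; rewrite !mxE tnth_mktuple rmorph_prod; apply: eq_bigr => j _.
exact: mevalXU.
Qed.

Lemma std_quadraticK p : std_quadratic (std_quadratic p) = (\prod_i p i 0) *: p.
Proof.
apply/colP => i; rewrite !mxE.
have -> : \prod_(j < 3 | j != i) std_quadratic p j 0 =
    \prod_(j < 3 | j != i) \prod_(k < 3 | k != j) p k 0.
  by apply: eq_bigr => j _; rewrite mxE.
have prodE (P : pred 'I_3) (u : 'I_3 -> F) : \prod_(j < 3 | P j) u j =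
    (if P 0 then u 0 else 1) * (if P 1 then u 1 else 1) *
    (if P 2%:R then u 2%:R else 1).
  rewrite big_mkcond !big_ord_recl big_ord0 /= mulr1 mulrA.
  by congr (_ * (if P _ then u _ else 1) * (if P _ then u _ else 1)); apply: val_inj.
have h : (i == 0) || (i == 1) || (i == 2%:R :> 'I_3) by case: i => [[|[|[]]]].
by rewrite !prodE; case/orP: h => [/orP[]|] /eqP -> /=; ring.
Qed.

End Quadratic.

Section Cremona.
Variable F : fieldType.
Implicit Types (f g h : {mpoly F[3]}) (p q : 'cV[F]_3) (A B : 'M[F]_3).
Implicit Types (i j k : 'I_3) (m : 'X_{1..3}).
Local Notation mult := PlaneCurve.multiplicity.
Local Notation irreducible := PlaneCurve.irreducible.
Local Notation vertex i := (delta_mx i 0%R : 'cV[F]_3).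

Lemma monomial_part f : f != 0 ->
  exists2 g, f = 'X_[[multinom ord (coord i) f | i < 3]] * g &
    forall i, ord (coord i) g = 0%N.
Proof.
move=> f0; set mu := [multinom _ | _ < 3].
pose g := \sum_(m <- msupp f) f@_m *: 'X_[(m - mu)%MM].
have fE : f = 'X_[mu] * g.
  rewrite [LHS]mpolyE mulr_sumr; apply: eq_big_seq => m ms.
  rewrite -scalerAr -mpolyXD addmC submK //.
  by apply/mnm_lepP => i; rewrite mnmE (ord_le (coord i) ms).
exists g => // i; have g0 : g != 0.
  by apply: contraNneq f0 => g0; rewrite fE g0 mulr0.
have := ordMX (coord i) mu g0; rewrite -fE.
by rewrite /= {2}/coord mnmE; lia.
Qed.

Lemma irreducible_coord f i : irreducible f -> ord (coord i) f != 0%N ->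
  exists2 c, c != 0 & f = c *: 'X_i.
Proof.
move=> [f0 fu fi] oi; have [g fE go] := monomial_part f0.
set mu := [multinom _ | _ < 3] in fE.
have fE' : f = 'X_i * ('X_[(mu - U_(i))%MM] * g).
  by rewrite mulrA -mpolyXD addmC submK // lep1mP mnmE.
have Xi0 : ('X_i : {mpoly F[3]}) != 0 by apply: mpolyX_neq0.
case: (fi _ _ fE') => [|/unit_const [c c0 E]].
  have X1 : ('X_i : {mpoly F[3]}) \is 1.-homog by rewrite dhomogX /= mdeg1.
  by rewrite (homog_unit Xi0 X1).
by exists c => //; rewrite fE' E mulrC mul_mpolyC.
Qed.

Lemma mult_mon m q : (forall i, q i 0 != 0) -> mult ('X_[m] : {mpoly F[3]}) q = 0%N.
Proof.
move=> q0; apply/eqP; rewrite mult_eq0 ?mpolyX_neq0 // mevalX.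
by apply/prodf_neq0 => i _; rewrite expf_neq0.
Qed.

Lemma std_quadratic_neq0 q : (forall i, q i 0 != 0) ->
  forall i, std_quadratic q i 0 != 0.
Proof. by move=> q0 i; rewrite mxE; apply/prodf_neq0 => j _. Qed.

Lemma mult_quad_ge f q : f != 0 -> (mult f (std_quadratic q) <= mult (quad f) q)%N.
Proof.
by move=> f0; rewrite -eval_quad_tuple; apply: mult_comp_ge; apply: quad_neq0.
Qed.

(** Off the coordinate lines the quadratic map is an involution up to a nonzero
    scalar, so multiplicities cannot grow when it is applied. *)
Lemma mult_quad d f q : f != 0 -> f \is d.-homog -> (forall i, q i 0 != 0) ->
  mult (quad f) (std_quadratic q) = mult f q.
Proof.
move=> f0 fd q0; apply/eqP; rewrite eqn_leq; apply/andP; split.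
  apply: leq_trans (mult_quad_ge _ (quad_neq0 f0)) _.
  by rewrite (quadK fd) multM ?mpolyX_neq0 // mult_mon.
have := mult_quad_ge (std_quadratic q) f0.
by rewrite std_quadraticK (mult_scale _ _ f0 fd) //; apply/prodf_neq0.
Qed.

(** For a form f divisible by no coordinate, quad f = 'X_[mu] * g, where the
    exponents in mu are the multiplicities of f at the vertices, and g defines the
    strict transform. *)
Section QuadraticTransform.
Variables (d : nat) (f : {mpoly F[3]}).
Hypotheses (f0 : f != 0) (fd : f \is d.-homog).
Hypothesis f_coord : forall i, ord (coord i) f = 0%N.
Let mu := [multinom mult f (vertex i) | i < 3].

Lemma quad_factor : exists2 g, quad f = 'X_[mu] * g & forall i, ord (coord i) g = 0%N.
Proof.
have [g gE go] := monomial_part (quad_neq0 f0); exists g => //.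
rewrite gE; congr ('X_[_] * _); apply/mnmP => i; rewrite !mnmE.
rewrite (mult_coord _ f0 fd) -[RHS]add0n.
apply: (@ord_quad _ (coord i) (wt i) 0 f) => // m _.
by rewrite /= /coord mnmE.
Qed.

Variable g : {mpoly F[3]}.
Hypotheses (gE : quad f = 'X_[mu] * g) (g_coord : forall i, ord (coord i) g = 0%N).

Lemma quad_factor_neq0 : g != 0.
Proof. by apply: contraNneq (quad_neq0 f0) => g0; rewrite gE g0 mulr0. Qed.

Lemma quad_factor_homog :
  exists2 e, g \is e.-homog & (2 * d = e + \sum_i mult f (vertex i))%N.
Proof.
have h0 : 'X_[mu] * g != 0 by rewrite -gE quad_neq0.
have hd : 'X_[mu] * g \is (2 * d).-homog by rewrite -gE quad_homog.
have [k [l [muk gl ->]]] := homog_factor h0 hd.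
exists l => //; rewrite addnC; congr (_ + _)%N.
have := muk; rewrite dhomogX => /eqP <-; rewrite /= mdegE.
by apply: eq_bigr => i _; rewrite mnmE.
Qed.

(** The weight of quad_mnm m at the vertex i is d + m i, and m i = 0 for some m in f,
    since f is not divisible by the coordinate i. *)
Lemma mult_quad_factor_vertex i :
  (mult g (vertex i) + \sum_(j | j != i) mult f (vertex j) = d)%N.
Proof.
have [e ge _] := quad_factor_homog; have g0 := quad_factor_neq0.
rewrite (mult_coord _ g0 ge).
have h : ord (wt i) (quad f) = (d + ord (coord i) f)%N.
  apply: (@ord_quad _ (wt i) (coord i) d f) => // m ms /=; have /dhomogP/(_ _ ms) /= <- := fd.
  have := mdeg_wt i (quad_mnm m); rewrite mdeg_quad mnmE /coord.
  by have := mdeg_wt i m; lia.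
have := ordMX (wt i) mu g0; rewrite -gE h f_coord addn0 => ->.
rewrite addnC; congr (_ + _)%N; rewrite /= /wt.
by apply: eq_bigr => j _; rewrite mnmE.
Qed.

Lemma mult_quad_factor q : (forall i, q i 0 != 0) ->
  mult g (std_quadratic q) = mult f q.
Proof.
move=> q0; rewrite -(mult_quad f0 fd q0) gE multM ?mpolyX_neq0 ?quad_factor_neq0 //.
by rewrite mult_mon //; apply: std_quadratic_neq0.
Qed.

Lemma coordM g1 g2 : g1 != 0 -> g2 != 0 -> (forall i, ord (coord i) (g1 * g2) = 0%N) ->
  (forall i, ord (coord i) g1 = 0%N) /\ (forall i, ord (coord i) g2 = 0%N).
Proof.
by move=> n1 n2 h; split=> i; have := h i; rewrite ordM //; lia.
Qed.

(** Cancelling monomials, the factorizations g = g1 g2 correspond to those of f,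
    and only constants become monomials. *)
Lemma quad_factor_irreducible : irreducible f -> irreducible g.
Proof.
move=> [_ fu fi]; have g0 := quad_factor_neq0.
have unit_of (h : {mpoly F[3]}) (k : nat) r nu : h != 0 -> h \is k.-homog ->
    (forall i, ord (coord i) h = 0%N) -> quad h = 'X_[nu] * r ->
    r \is a GRing.unit -> h \is a GRing.unit.
  move=> h0 hk ho hE /unit_const [c c0 rc].
  have : quad (quad h) = c *: 'X_[quad_mnm nu].
    by rewrite hE rc mulrC mul_mpolyC /quad comp_mpolyZ -/(quad _) quadX.
  rewrite (quadK hk) => E.
  have nuE : quad_mnm nu = [multinom k | _ < 3].
    apply/mnmP => i; have := congr1 (ord (coord i)) E.
    by rewrite ordMX // ho ordZ // ordX /= /coord addn0 => <-.
  have : h = c%:MP.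
    apply: (mulfI (mpolyX_neq0 _ [multinom k | _ < 3])).
    by rewrite E nuE mulrC mul_mpolyC.
  by move=> ->; rewrite rmorph_unit // unitfE.
split=> //.
  apply: contraNN fu => /unit_const [c c0 gc].
  apply: (unit_of f d g mu) => //.
  by rewrite gc rmorph_unit // unitfE.
move=> g1 g2 gg; have [e ge _] := quad_factor_homog.
have := g0; rewrite gg mulf_eq0 negb_or => /andP[n1 n2].
have [k [l [h1 h2 _]]] : exists k l : nat,
    [/\ g1 \is k.-homog, g2 \is l.-homog & e = (k + l)%N].
  by apply: homog_factor; rewrite -gg.
have [o1 o2] : (forall i, ord (coord i) g1 = 0%N) /\ (forall i, ord (coord i) g2 = 0%N).
  by apply: coordM => // i; rewrite -gg.
have [r1 E1 p1] := monomial_part (quad_neq0 n1).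
have [r2 E2 p2] := monomial_part (quad_neq0 n2).
set nu1 := [multinom _ | _ < 3] in E1; set nu2 := [multinom _ | _ < 3] in E2.
have r10 : r1 != 0 by apply: contraNneq (quad_neq0 n1) => z; rewrite E1 z mulr0.
have r20 : r2 != 0 by apply: contraNneq (quad_neq0 n2) => z; rewrite E2 z mulr0.
have quadM (a b : {mpoly F[3]}) : quad (a * b) = quad a * quad b by apply: rmorphM.
have E : 'X_[[multinom d | _ < 3]] * f = 'X_[(quad_mnm mu + nu1 + nu2)%MM] * (r1 * r2).
  rewrite -(quadK fd) gE quadM quadX gg quadM E1 E2 !mpolyXD; ring.
have muE : (quad_mnm mu + nu1 + nu2)%MM = [multinom d | _ < 3].
  apply/mnmP => i; have := congr1 (ord (coord i)) E.
  by rewrite !ordMX ?mulf_neq0 // ordM // p1 p2 f_coord /= /coord !addn0 => <-.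
have : f = r1 * r2.
  by apply: (mulfI (mpolyX_neq0 _ [multinom d | _ < 3])); rewrite E muE.
by case/fi => u; [left; apply: (unit_of g1 k r1 nu1) | right; apply: (unit_of g2 l r2 nu2)].
Qed.

End QuadraticTransform.

(** The strict transform of an irreducible curve under a quadratic map is either
    contracted (a side of the triangle of base points) or an irreducible curve,
    whose degree and multiplicities are given by the usual formulas. *)
Lemma cremona_curve A d f : A \in unitmx ->
  PlaneCurve.form_of_degree d f -> irreducible f ->
  (exists2 a, d = 1%N & forall p, mult f p = ((invmx A *m p) a 0%R == 0) :> nat) \/
  (exists e g, [/\ PlaneCurve.form_of_degree e g, irreducible g,
     (2 * d = e + \sum_a mult f (col a A))%N,
     forall a, (mult g (col a A) + \sum_(b | b != a) mult f (col b A) = d)%N &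
     forall p, (forall a, (invmx A *m p) a 0 != 0) ->
       mult g (quadratic_map A p) = mult f p]).
Proof.
move=> Au fd fi; have f0 : f != 0 by case: fi.
have vE a : A *m vertex a = col a A by rewrite colE.
pose f' := change f A; have f'i : irreducible f' by apply: irreducible_change.
have f'0 : f' != 0 by case: f'i.
have f'd : f' \is d.-homog by apply: change_homog.
have multf' p : mult f' p = mult f (A *m p) by apply: mult_change.
have [/forallP o|/forallPn [a oa]] := boolP [forall a, ord (coord a) f' == 0%N].
  have {}o a : ord (coord a) f' = 0%N by apply/eqP/o.
  right; have [g gE go] := quad_factor f'0 f'd.
  have gi := quad_factor_irreducible f'0 f'd o gE go f'i.
  have g0 : g != 0 by case: gi.
  have [e ge eE] := quad_factor_homog f'0 f'd gE.
  have multg p : mult (change g (invmx A)) p = mult g (invmx A *m p).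
    by apply: mult_change => //; rewrite unitmx_inv.
  exists e, (change g (invmx A)); split.
  - exact: change_homog.
  - by apply: irreducible_change => //; rewrite unitmx_inv.
  - by rewrite eE; congr (_ + _)%N; apply: eq_bigr => a _; rewrite multf' vE.
  - move=> a; rewrite multg -vE mulKmx //.
    rewrite -[RHS](mult_quad_factor_vertex f'0 f'd o gE a); congr (_ + _)%N.
    by apply: eq_bigr => b _; rewrite multf' vE.
  - move=> p pA; rewrite multg /quadratic_map mulKmx //.
    by rewrite (mult_quad_factor f'0 f'd gE pA) multf' mulKVmx.
left; exists a.
  have [c c0 fE] := irreducible_coord f'i oa.
  by apply: (dhomog_uniq f'0 f'd); rewrite fE dhomogZ // dhomogX /= mdeg1.
have [c c0 fE] := irreducible_coord f'i oa.
move=> p; rewrite -[in LHS](mulKVmx Au p) -multf' fE multZ //.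
have -> : 'X_a = line (delta_mx 0 a : 'rV[F]_3).
  rewrite /line (bigD1 a) //= mxE !eqxx scale1r big1 ?addr0 // => j ja.
  by rewrite mxE (negPf ja) andbF scale0r.
rewrite mult_line; last first.
  by apply/eqP => /matrixP/(_ 0 a); rewrite !mxE !eqxx => /eqP; rewrite oner_eq0.
rewrite -rowE; congr (nat_of_bool _); apply/eqP/eqP => [/matrixP/(_ 0 0)|h].
  by rewrite !mxE.
by apply/matrixP => i j; rewrite !ord1 mxE h mxE.
Qed.

End Cremona.

(** * Factorization and interpolation *)

Section FormInduction.
Variable F : fieldType.
Implicit Types (f g h : {mpoly F[3]}).
Local Notation irreducible := PlaneCurve.irreducible.
Local Notation form_of_degree := PlaneCurve.form_of_degree.

(** Nonzero forms are products of irreducible forms, by induction on the degree. *)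
Lemma form_ind (Q : nat -> {mpoly F[3]} -> Prop) :
  (forall c, c != 0 -> Q 0%N c%:MP) ->
  (forall d f, form_of_degree d f -> irreducible f -> Q d f) ->
  (forall d e g h, g != 0 -> h != 0 -> Q d g -> Q e h -> Q (d + e)%N (g * h)) ->
  forall d f, f != 0 -> form_of_degree d f -> Q d f.
Proof.
move=> Qc Qi QM; elim/ltn_ind => d IHd f f0 fd.
have [d0|d_gt0] := posnP d.
  by rewrite d0 in fd *; have [c c0 ->] := unit_homog f0 fd; apply: Qc.
case: (boolp.EM (exists g h, [/\ f = g * h, g \isn't a GRing.unit &
                                 h \isn't a GRing.unit])) => [[g [h [fE gu hu]]]|nfac].
  have gh0 : g * h != 0 by rewrite -fE.
  have ghd : g * h \is d.-homog by rewrite -fE.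
  have [k [l [gk hl dE]]] := homog_factor gh0 ghd.
  have := gh0; rewrite mulf_eq0 negb_or => /andP[g0 h0].
  have kl : k != 0%N /\ l != 0%N by rewrite -(homog_unit g0 gk) -(homog_unit h0 hl).
  by rewrite fE dE; apply: QM => //; apply: IHd => //; lia.
apply: Qi => //; split=> // [|g h fE]; first by rewrite (homog_unit f0 fd); lia.
have [gu|gu] := boolP (g \is a GRing.unit); first by left.
have [hu|hu] := boolP (h \is a GRing.unit); first by right.
by case: nfac; exists g, h.
Qed.

End FormInduction.

Section Interpolation.
Variable F : fieldType.
Local Notation mult := PlaneCurve.multiplicity.

Lemma underdetermined_system (I K : finType) (M : I -> K -> F) : (#|K| < #|I|)%N ->
  exists2 u : I -> F, exists i, u i != 0 & forall k, \sum_i u i * M i k = 0.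
Proof.
move=> KI; pose A := \matrix_(a < #|I|, b < #|K|) M (enum_val a) (enum_val b).
have : kermx A != 0.
  rewrite kermx_eq0 /row_free; have := rank_leq_col A.
  by move: KI; case: eqP => // ->; rewrite ltnNge => /negP.
move=> /rowV0Pn [v /sub_kermxP vA v0]; exists (fun i => v 0 (enum_rank i)).
  have [j vj] : exists j, v 0 j != 0 by apply/rV0Pn.
  by exists (enum_val j); rewrite enum_valK.
move=> k; have := congr1 (fun B : 'M_(1, _) => B 0 (enum_rank k)) vA.
rewrite !mxE => vk; rewrite -[RHS]vk (reindex (@enum_rank I)) /=; last first.
  by apply: onW_bij; apply: enum_rank_bij.
by apply: eq_bigr => i _; rewrite mxE !enum_rankK.
Qed.

Lemma card_sigma (I : finType) (T : I -> finType) :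
  #|{: {i : I & T i}}| = (\sum_i #|T i|)%N.
Proof. by rewrite card_tagged sumnE big_map big_enum. Qed.

Lemma card_triangle d : #|{: {s : 'I_d & 'I_s.+1}}| = 'C(d.+1, 2).
Proof.
rewrite card_sigma -bin2_sum big_nat_recl // add0n big_mkord.
by apply: eq_bigr => s _; rewrite card_ord.
Qed.

(** Indexing by the weight s at the vertex 0 and by one more exponent b <= s makes
    both the forms of degree d and the conditions at a point a triangle. *)
Definition triangle_mnm d (s b : nat) : 'X_{1..3} :=
  [multinom nth 0%N [:: (d - s)%N; b; (s - b)%N] i | i < 3].

Lemma mnm3P (m m' : 'X_{1..3}) : m 0%R = m' 0 -> m 1 = m' 1 -> m 2%:R = m' 2%:R -> m = m'.
Proof.
move=> h0 h1 h2; apply/mnmP => i.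
have : (i == 0) || (i == 1) || (i == 2%:R :> 'I_3) by case: i => [[|[|[]]]].
by case/orP => [/orP[]|] /eqP ->.
Qed.

Lemma wt0E m : wt 0%R m = (m 1%R + m 2%:R%R)%N.
Proof.
rewrite /wt big_mkcond !big_ord_recl big_ord0 /= add0n addn0.
by congr (m _ + m _)%N; apply: val_inj.
Qed.

Lemma triangle_mnm_wt d s b : (b <= s)%N -> wt 0%R (triangle_mnm d s b) = s.
Proof. by move=> bs; rewrite wt0E !mnmE /=; lia. Qed.

Lemma triangle_mnmE d m : mdeg m = d -> m = triangle_mnm d (wt 0%R m) (m 1%R).
Proof.
move=> md; have := mdeg_wt 0%R m; have := wt0E m => e1 e2.
by apply: mnm3P; rewrite mnmE /=; lia.
Qed.

Lemma mdeg_triangle d s b : (b <= s <= d)%N -> mdeg (triangle_mnm d s b) = d.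
Proof.
by move=> /andP[bs sd]; rewrite (mdeg_wt 0%R) triangle_mnm_wt // mnmE /=; lia.
Qed.

(** Gaussian elimination applied to the row p^T, which has rank 1. *)
Lemma move_vertex (p : 'cV[F]_3) : p != 0 ->
  exists2 B : 'M[F]_3, B \in unitmx & B *m delta_mx 0 0 = p.
Proof.
move=> p0; have r1 : \rank p^T = 1%N.
  by apply/eqP; rewrite rank_rV trmx_eq0 p0.
exists ((col_ebase p^T) 0 0 *: (row_ebase p^T)^T).
  rewrite unitmxZ ?unitmx_tr ?row_ebase_unit //.
  have := col_ebase_unit p^T; rewrite unitmxE [\det _](_ : _ = col_ebase p^T 0 0) //.
  by rewrite {1}[col_ebase _]mx11_scalar det_scalar1.
apply: trmx_inj; rewrite trmx_mul -[RHS]mulmx_ebase r1.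
rewrite linearZ /= trmxK trmx_delta -scalemxAr {2}[col_ebase _]mx11_scalar.
rewrite mul_scalar_mx -scalemxAl; congr (_ *: (_ *m _)).
by apply/matrixP => i j; rewrite !ord1 !mxE eqxx /= andbT -val_eqE eq_sym.
Qed.

Lemma triangle_mnm_inj d : injective (fun x : {s : 'I_d.+1 & 'I_s.+1} =>
  triangle_mnm d (tag x) (tagged x)).
Proof.
move=> [s b] [s' b'] /= e.
have es : s = s'.
  apply: val_inj; have := congr1 (wt 0%R) e.
  by rewrite !triangle_mnm_wt // -ltnS; apply: ltn_ord.
case: s' / es b' e => b' e; congr existT; apply: val_inj.
by have := congr1 (fun m : 'X_{1..3} => m 1%R) e; rewrite !mnmE.
Qed.

(** A point of multiplicity m imposes at most binomial (m + 1, 2) linear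
    conditions on forms: after moving it to a vertex, one for each monomial of
    weight less than m. *)
Lemma form_with_multiplicities n (P : 'I_n -> 'cV[F]_3) (d : nat) (m : 'I_n -> nat) :
  (forall i, P i != 0) -> (\sum_i 'C((m i).+1, 2) < 'C(d.+2, 2))%N ->
  exists f, [/\ f != 0, PlaneCurve.form_of_degree d f &
                forall i, (m i <= mult f (P i))%N].
Proof.
move=> P0 md.
have [B Bu BP] : exists2 B : 'I_n -> 'M[F]_3, forall i, B i \in unitmx &
    forall i, B i *m delta_mx 0 0 = P i.
  have /boolp.choice [B hB] i : exists B : 'M[F]_3,
      B \in unitmx /\ B *m delta_mx 0 0 = P i.
    by have [B] := move_vertex (P0 i); exists B.
  by exists B => i; have [] := hB i.
pose I := {s : 'I_d.+1 & 'I_s.+1}.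
pose K := {i : 'I_n & {s : 'I_(m i) & 'I_s.+1}}.
pose mon (x : I) := triangle_mnm d (tag x) (tagged x).
pose cond (f : {mpoly F[3]}) (k : K) :=
  (change f (B (tag k)))@_(triangle_mnm d (tag (tagged k)) (tagged (tagged k))).
have [|u [i0 ui0] hu] := @underdetermined_system I K (fun x k => cond 'X_[mon x] k).
  rewrite card_triangle card_sigma; apply: leq_ltn_trans md.
  by apply: leq_sum => i _; rewrite card_triangle.
pose f := \sum_x u x *: 'X_[mon x] : {mpoly F[3]}.
have fc x : f@_(mon x) = u x.
  rewrite raddf_sum (bigD1 x) //= mcoeffZ mcoeffX eqxx mulr1 big1 ?addr0 // => y yx.
  by rewrite mcoeffZ mcoeffX (inj_eq (@triangle_mnm_inj d)) (negPf yx) mulr0.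
have f0 : f != 0 by apply: contraNneq ui0 => f0; rewrite -fc f0 mcoeff0.
have fd : f \is d.-homog.
  rewrite rpred_sum // => -[s b] _; rewrite dhomogZ // dhomogX /=.
  by rewrite mdeg_triangle // -ltnS ltn_ord -ltnS ltn_ord.
exists f; split=> // i; rewrite -BP -mult_change //.
have g0 : change f (B i) != 0 by apply: change_neq0.
apply: leq_trans (mult_coord_ge 0 g0); apply: ord_ge => // m' m's.
rewrite leqNgt; apply/negP => /= lt_m.
have /dhomogP/(_ _ m's)/triangle_mnmE m'E : change f (B i) \is d.-homog.
  exact: change_homog.
have le1 : (m' 1%R < (wt 0%R m').+1)%N by rewrite ltnS wt0E leq_addr.
pose k : K := Tagged (fun i => {s : 'I_(m i) & 'I_s.+1})
  (Tagged (fun s : 'I_(m i) => 'I_s.+1) (Ordinal le1 : 'I_(Ordinal lt_m).+1)).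
have : cond f k = 0.
  apply: etrans (hu k); rewrite /cond /change [f \mPo _]linear_sum raddf_sum /=.
  by apply: eq_bigr => x _; rewrite comp_mpolyZ mcoeffZ.
rewrite /cond /= -m'E => e0.
by move: m's; rewrite mcoeff_msupp e0 eqxx.
Qed.

End Interpolation.

End PlaneForms.

From mathcomp Require Import all_classical all_reals all_analysis.
Import numFieldNormedType.Exports.
Local Open Scope ring_scope.
Local Open Scope classical_set_scope.


(** * The lattice of the blowup and its reflections *)

Section Lattice.
Variables (R : realType) (n : nat).
Local Notation N1 := 'cV[R]_n.+1.
Local Notation dot := (@intersection R n).
Local Notation h := (line_class R n).
Local Notation e := (@exc R n).
Local Notation K := (canonical_class R n).
Implicit Types (u v w r : N1) (i j k l : 'I_n).

Definition deg v : R := v 0 0.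
(** With this sign mul v i is v.e_i, the multiplicity at P_i for a strict
    transform. *)
Definition mul v i : R := - v (lift ord0 i) 0.

Lemma vecP v w : deg v = deg w -> (forall i, mul v i = mul w i) -> v = w.
Proof.
move=> hd hm; apply/colP => a; case: (unliftP ord0 a) => [i ->|->]; last exact: hd.
by apply: oppr_inj; apply: hm.
Qed.

Lemma degD v w : deg (v + w) = deg v + deg w. Proof. by rewrite /deg mxE. Qed.
Lemma degN v : deg (- v) = - deg v. Proof. by rewrite /deg mxE. Qed.
Lemma degZ c v : deg (c *: v) = c * deg v. Proof. by rewrite /deg mxE. Qed.
Lemma mulD v w i : mul (v + w) i = mul v i + mul w i.
Proof. by rewrite /mul mxE opprD. Qed.
Lemma mulN v i : mul (- v) i = - mul v i. Proof. by rewrite /mul mxE. Qed.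
Lemma mulZ c v i : mul (c *: v) i = c * mul v i. Proof. by rewrite /mul mxE mulrN. Qed.
Lemma deg_h : deg h = 1. Proof. by rewrite /deg mxE !eqxx. Qed.
Lemma mul_h i : mul h i = 0.
Proof. by rewrite /mul mxE eq_sym (negPf (neq_lift _ _)) oppr0. Qed.
Lemma deg_e i : deg (e i) = 0.
Proof. by rewrite /deg mxE (negPf (neq_lift _ _)). Qed.
Lemma mul_e i j : mul (e i) j = - (i == j)%:R.
Proof. by rewrite /mul mxE (inj_eq lift_inj) eqxx andbT eq_sym. Qed.
Lemma deg_sum (I : finType) (E : I -> N1) : deg (\sum_i E i) = \sum_i deg (E i).
Proof. by rewrite /deg summxE. Qed.
Lemma mul_sum (I : finType) (E : I -> N1) j : mul (\sum_i E i) j = \sum_i mul (E i) j.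
Proof. by rewrite /mul summxE -sumrN. Qed.

Lemma deg_comb (a : R) (b : 'I_n -> R) : deg (a *: h - \sum_i b i *: e i) = a.
Proof.
rewrite degD degN degZ deg_h deg_sum big1 ?subr0 ?mulr1 // => i _.
by rewrite degZ deg_e mulr0.
Qed.

Lemma mul_comb (a : R) (b : 'I_n -> R) j : mul (a *: h - \sum_i b i *: e i) j = b j.
Proof.
rewrite mulD mulN mulZ mul_h mulr0 add0r mul_sum (bigD1 j) //= mulZ mul_e eqxx.
rewrite big1 ?addr0 ?mulrN1 ?opprK // => i ij.
by rewrite mulZ mul_e (negPf ij) oppr0 mulr0.
Qed.

Lemma vecE v : v = deg v *: h - \sum_i mul v i *: e i.
Proof. by apply: vecP => [|j]; rewrite ?deg_comb ?mul_comb. Qed.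

Lemma deg_K : deg K = -3.
Proof.
rewrite degD degN degZ deg_h deg_sum big1 ?addr0 ?mulr1 // => i _.
exact: deg_e.
Qed.

Lemma mul_K i : mul K i = -1.
Proof.
rewrite mulD mulN mulZ mul_h mulr0 oppr0 add0r mul_sum (bigD1 i) //= mul_e eqxx.
by rewrite big1 ?addr0 // => j ji; rewrite mul_e (negPf ji) oppr0.
Qed.

Lemma dotE v w : dot v w = deg v * deg w - \sum_i mul v i * mul w i.
Proof. by rewrite /intersection; congr (_ - _); apply: eq_bigr => i _; rewrite mulrNN. Qed.

Lemma dotC v w : dot v w = dot w v.
Proof.
by rewrite !dotE mulrC; congr (_ - _); apply: eq_bigr => i _; rewrite mulrC.
Qed.

Lemma dotDl u v w : dot (u + v) w = dot u w + dot v w.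
Proof.
rewrite !dotE degD mulrDl addrACA -opprD -big_split; congr (_ - _).
by apply: eq_bigr => i _; rewrite mulD mulrDl.
Qed.

Lemma dotZl c v w : dot (c *: v) w = c * dot v w.
Proof.
rewrite !dotE degZ mulrBr mulrA mulr_sumr; congr (_ - _).
by apply: eq_bigr => i _; rewrite mulZ mulrA.
Qed.

Lemma dotNl v w : dot (- v) w = - dot v w.
Proof. by rewrite -scaleN1r dotZl mulN1r. Qed.
Lemma dotBl u v w : dot (u - v) w = dot u w - dot v w.
Proof. by rewrite dotDl dotNl. Qed.
Lemma dotDr u v w : dot w (u + v) = dot w u + dot w v.
Proof. by rewrite dotC dotDl !(dotC w). Qed.
Lemma dotZr c v w : dot w (c *: v) = c * dot w v.
Proof. by rewrite dotC dotZl (dotC w). Qed.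
Lemma dotNr v w : dot w (- v) = - dot w v.
Proof. by rewrite dotC dotNl (dotC w). Qed.
Lemma dotBr u v w : dot w (u - v) = dot w u - dot w v.
Proof. by rewrite dotDr dotNr. Qed.
Lemma dot0l w : dot 0 w = 0.
Proof. by rewrite -(scale0r 0) dotZl mul0r. Qed.
Lemma dot_suml (I : finType) (E : I -> N1) w : dot (\sum_i E i) w = \sum_i dot (E i) w.
Proof.
by elim/big_rec2: _ => [|i y z _ <-]; rewrite ?dot0l ?dotDl.
Qed.
Lemma dot_sumr (I : finType) (E : I -> N1) w : dot w (\sum_i E i) = \sum_i dot w (E i).
Proof. by rewrite dotC dot_suml; apply: eq_bigr => i _; rewrite dotC. Qed.

Lemma dot_h v : dot v h = deg v.
Proof.
by rewrite dotE deg_h mulr1 big1 ?subr0 // => i _; rewrite mul_h mulr0.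
Qed.

Lemma dot_e v i : dot v (e i) = mul v i.
Proof.
rewrite dotE deg_e mulr0 add0r (bigD1 i) //= mul_e eqxx mulrN1 big1 ?addr0 ?opprK //.
by move=> j ji; rewrite mul_e eq_sym (negPf ji) oppr0 mulr0.
Qed.

Lemma dot_K v : dot v K = \sum_i mul v i - 3 * deg v.
Proof.
rewrite dotE deg_K mulrN mulrC addrC -sumrN; congr (_ - _).
by apply: eq_bigr => i _; rewrite mul_K mulrN1 opprK.
Qed.

Definition dotE' := (dotDl, dotDr, dotBl, dotBr, dotNl, dotNr, dotZl, dotZr).

Definition refl r v : N1 := v + dot v r *: r.

Lemma deg_refl r v : deg (refl r v) = deg v + dot v r * deg r.
Proof. by rewrite /refl degD degZ. Qed.
Lemma mul_refl r v i : mul (refl r v) i = mul v i + dot v r * mul r i.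
Proof. by rewrite /refl mulD mulZ. Qed.
Lemma reflD r v w : refl r (v + w) = refl r v + refl r w.
Proof. by rewrite /refl dotDl scalerDl addrACA. Qed.
Lemma reflZ r c v : refl r (c *: v) = c *: refl r v.
Proof. by rewrite /refl dotZl scalerDr scalerA. Qed.

Lemma dot_refl r v w : dot r r = -2 -> dot (refl r v) (refl r w) = dot v w.
Proof.
by move=> rr; rewrite /refl !dotE' rr (dotC r w); ring.
Qed.

Lemma reflK r : dot r r = -2 -> involutive (refl r).
Proof.
move=> rr v; rewrite /refl !dotE' rr -addrA -scalerDl.
by rewrite [X in X *: _](_ : _ = 0) ?scale0r ?addr0 //; ring.
Qed.

(** The reflection in s_r(s) is the conjugate of the reflection in s. *)
Lemma refl_conj r s v : dot r r = -2 ->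
  refl r (refl s (refl r v)) = refl (refl r s) v.
Proof.
move=> rr; transitivity (refl r (refl r v + dot (refl r v) s *: s)); first by [].
rewrite reflD reflZ (reflK rr).
transitivity (v + dot v (refl r s) *: refl r s); last by [].
by rewrite -(dot_refl v (refl r s) rr) (reflK rr s).
Qed.

(** A root: its reflection is the action of the quadratic transformation at the
    points i, j, k. *)
Definition alpha i j k : N1 := h - e i - e j - e k.

Lemma dot_alpha v i j k : dot v (alpha i j k) = deg v - mul v i - mul v j - mul v k.
Proof. by rewrite !dotBr dot_h !dot_e. Qed.

Lemma dot_exc_diff v i j : dot v (e i - e j) = mul v i - mul v j.
Proof. by rewrite dotBr !dot_e. Qed.

Lemma alpha_sq i j k : i != j -> i != k -> j != k -> dot (alpha i j k) (alpha i j k) = -2.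
Proof.
move=> ij ik jk; rewrite dot_alpha /alpha !degD !degN !mulD !mulN deg_h !deg_e !mul_h !mul_e.
rewrite !eqxx (eq_sym j i) (eq_sym k i) (eq_sym k j) (negPf ij) (negPf ik) (negPf jk) /=; ring.
Qed.

Lemma exc_diff_sq i j : i != j -> dot (e i - e j) (e i - e j) = -2.
Proof.
move=> ij; rewrite dot_exc_diff !mulD !mulN !mul_e !eqxx (eq_sym j i) (negPf ij) /=; ring.
Qed.

Lemma alpha_K i j k : dot (alpha i j k) K = 0.
Proof.
rewrite dotC dot_alpha deg_K !mul_K; ring.
Qed.

Lemma exc_diff_K i j : dot (e i - e j) K = 0.
Proof. by rewrite dotC dot_exc_diff !mul_K subrr. Qed.

Lemma cremona_imageE i j k a : i != j -> i != k -> j != k ->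
  cremona_image R i j k a = refl (alpha i j k) (delta_mx a 0).
Proof.
move=> ij ik jk; rewrite /cremona_image /refl.
case: (unliftP ord0 a) => [a' ->|->]; last first.
  rewrite eqxx -/h dot_alpha deg_h !mul_h !subr0 scale1r /alpha.
  by rewrite scaler_nat mulr2n !addrA.
rewrite eq_sym (negPf (neq_lift _ _)) !(inj_eq lift_inj) -/(e a').
rewrite dot_alpha deg_e !mul_e sub0r !opprK /alpha.
have -> : h - e i - e j - e k = h - (e i + e j + e k) by rewrite !opprD !addrA.
case: eqVneq => [->|ai].
  rewrite (negPf ij) (negPf ik) !addr0 scale1r.
  by apply: vecP => [|l]; rewrite ?(degD, degN, degZ, mulD, mulN, mulZ); ring.
case: eqVneq => [->|aj].
  rewrite (negPf jk) add0r !addr0 scale1r.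
  by apply: vecP => [|l]; rewrite ?(degD, degN, degZ, mulD, mulN, mulZ); ring.
case: eqVneq => [->|ak].
  rewrite !add0r scale1r.
  by apply: vecP => [|l]; rewrite ?(degD, degN, degZ, mulD, mulN, mulZ); ring.
by rewrite !addr0 scale0r addr0.
Qed.

Lemma cremona_mxE i j k v : i != j -> i != k -> j != k ->
  cremona_mx R i j k *m v = refl (alpha i j k) v.
Proof.
move=> ij ik jk.
have vE : v = \sum_a v a 0 *: delta_mx a 0.
  by rewrite {1}[v]matrix_sum_delta; apply: eq_bigr => a _; rewrite big_ord1.
rewrite [in RHS]vE /refl dot_suml scaler_suml -big_split.
apply/colP => b; rewrite mxE summxE; apply: eq_bigr => a _ /=.
transitivity ((v a 0 *: refl (alpha i j k) (delta_mx a 0)) b 0).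
  by rewrite [in LHS]mxE cremona_imageE // mulrC [RHS]mxE.
by rewrite -reflZ.
Qed.

End Lattice.

(** * The Cremona group *)

Section Group.
Variables (R : realType) (n : nat).
Hypothesis hn : (9 < n)%N.
Local Notation N1 := 'cV[R]_n.+1.
Local Notation dot := (@intersection R n).
Local Notation h := (line_class R n).
Local Notation e := (@exc R n).
Local Notation K := (canonical_class R n).
Local Notation W := (@cremona_group R n).
Implicit Types (u v w r : N1) (i j k l : 'I_n) (g : 'M[R]_n.+1).

Lemma mx_ext (A B : 'M[R]_n.+1) : (forall v, A *m v = B *m v) -> A = B.
Proof.
move=> AB; apply/matrixP => a b.
by have := congr1 (fun u : N1 => u a 0) (AB (delta_mx b 0)); rewrite -!colE !mxE.
Qed.

Lemma cremona_mx_gen i j k : i != j -> i != k -> j != k -> W (cremona_mx R i j k).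
Proof. by move=> ij ik jk; apply: gen_gen; exists i, j, k. Qed.

Lemma cremona_mxK i j k : i != j -> i != k -> j != k ->
  cremona_mx R i j k * cremona_mx R i j k = 1.
Proof.
move=> ij ik jk; apply: mx_ext => v; rewrite -mulmxE -mulmxA !cremona_mxE //.
by rewrite reflK ?alpha_sq // mul1mx.
Qed.

Inductive cremona_word : 'M[R]_n.+1 -> Prop :=
| word_nil : cremona_word 1
| word_cons i j k g : i != j -> i != k -> j != k -> cremona_word g ->
    cremona_word (cremona_mx R i j k * g).

Lemma word_mul g g' : cremona_word g -> cremona_word g' -> cremona_word (g * g').
Proof.
move=> wg wg'; elim: wg => [|i j k g1 ij ik jk _ IH]; first by rewrite mul1r.
by rewrite -mulrA; apply: word_cons.
Qed.

Lemma word_inv g : cremona_word g -> g \is a GRing.unit /\ cremona_word g^-1.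
Proof.
elim=> [|i j k g1 ij ik jk _ [g1u IH]].
  by rewrite unitr1 invr1; split=> //; apply: word_nil.
have c2 := cremona_mxK ij ik jk.
have cu : cremona_mx R i j k \is a GRing.unit by apply/unitrP; exists (cremona_mx R i j k).
split; first by rewrite unitrMl.
rewrite invrM //; apply: word_mul => //.
have -> : (cremona_mx R i j k)^-1 = cremona_mx R i j k * 1.
  by rewrite mulr1; apply: (mulrI cu); rewrite c2 divrr.
by apply: word_cons => //; apply: word_nil.
Qed.

Lemma cremona_groupP g : W g <-> cremona_word g.
Proof.
split; last first.
  elim=> [|i j k g1 ij ik jk _ IH]; first exact: gen_one.
  by apply: gen_mul => //; apply: cremona_mx_gen.
elim=> [|g1 [i [j [k [ij ik jk ->]]]]|g1 g2 _ w1 _ w2|g1 _ w1].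
- exact: word_nil.
- by rewrite -[cremona_mx _ _ _ _]mulr1; apply: word_cons => //; apply: word_nil.
- exact: word_mul.
- by have [] := word_inv w1.
Qed.

(** The generators are involutions, so inverses need not be considered. *)
Lemma cremona_group_ind (Q : 'M[R]_n.+1 -> Prop) : Q 1 ->
  (forall i j k g, i != j -> i != k -> j != k -> W g -> Q g ->
     Q (cremona_mx R i j k * g)) ->
  forall g, W g -> Q g.
Proof.
move=> Q1 QM g /cremona_groupP; elim=> // i j k g1 ij ik jk /cremona_groupP w1 Qg1.
exact: QM.
Qed.

Lemma W_unit g : W g -> g \is a GRing.unit.
Proof. by move=> /cremona_groupP/word_inv []. Qed.

Lemma W_K g : W g -> g *m K = K.
Proof.
move: g; apply: cremona_group_ind => [|i j k g ij ik jk _ IH]; first exact: mul1mx.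
rewrite -mulmxE -mulmxA IH cremona_mxE // /refl dotC alpha_K.
by rewrite scale0r addr0.
Qed.

Lemma W_dot g v w : W g -> dot (g *m v) (g *m w) = dot v w.
Proof.
move=> Wg; move: g Wg v w.
apply: cremona_group_ind => [v w|i j k g ij ik jk _ IH v w]; first by rewrite !mul1mx.
by rewrite -mulmxE -!mulmxA !cremona_mxE // dot_refl ?alpha_sq.
Qed.

Lemma W_mulVv g v : W g -> g^-1 *m (g *m v) = v.
Proof. by move=> Wg; rewrite mulmxA mulmxE mulVr ?mul1mx // W_unit. Qed.

Lemma W_mulvV g v : W g -> g *m (g^-1 *m v) = v.
Proof. by move=> Wg; rewrite mulmxA mulmxE mulrV ?mul1mx // W_unit. Qed.

Lemma W_adj g v w : W g -> dot (g *m v) w = dot v (g^-1 *m w).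
Proof. by move=> Wg; rewrite -(W_dot v (g^-1 *m w) Wg) W_mulvV. Qed.

Lemma W_dotK g v : W g -> dot (g *m v) K = dot v K.
Proof. by move=> Wg; rewrite -{1}(W_K Wg) W_dot. Qed.

Definition integral v := deg v \is a Num.int /\ forall i, mul v i \is a Num.int.

Lemma integral_D v w : integral v -> integral w -> integral (v + w).
Proof.
by move=> [dv mv] [dw mw]; split=> [|i]; rewrite ?degD ?mulD rpredD.
Qed.
Lemma integral_N v : integral v -> integral (- v).
Proof. by move=> [dv mv]; split=> [|i]; rewrite ?degN ?mulN rpredN. Qed.
Lemma integral_Z c v : c \is a Num.int -> integral v -> integral (c *: v).
Proof. by move=> ci [dv mv]; split=> [|i]; rewrite ?degZ ?mulZ rpredM. Qed.
Lemma integral_h : integral h.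
Proof. by split=> [|i]; rewrite ?deg_h ?mul_h ?rpred0 ?rpred1. Qed.
Lemma integral_e i : integral (e i).
Proof. by split=> [|j]; rewrite ?deg_e ?mul_e ?rpred0 // rpredN natr_int. Qed.

Lemma integral_dot v w : integral v -> integral w -> dot v w \is a Num.int.
Proof.
move=> [dv mv] [dw mw]; rewrite dotE rpredB ?rpredM ?rpred_sum // => i _.
by rewrite rpredM.
Qed.

Lemma integral_alpha i j k : integral (alpha R i j k).
Proof.
by do ?[apply: integral_D|apply: integral_N|apply: integral_e|apply: integral_h].
Qed.

Lemma integral_refl r v : integral r -> integral v -> integral (refl r v).
Proof.
by move=> hr hv; apply: integral_D => //; apply: integral_Z => //; apply: integral_dot.
Qed.

Lemma W_integral g v : W g -> integral v -> integral (g *m v).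
Proof.
move=> Wg iv; move: g Wg; apply: cremona_group_ind => [|i j k g ij ik jk _ IH].
  by rewrite mul1mx.
by rewrite -mulmxE -mulmxA cremona_mxE //; apply: integral_refl => //; apply: integral_alpha.
Qed.

Lemma exists_notin (s : seq 'I_n) : (size s < n)%N -> exists k, k \notin s.
Proof.
move=> sn; apply: contrapT => hs.
have : (size (enum 'I_n) <= size s)%N.
  apply: uniq_leq_size (enum_uniq _) _ => k _.
  by apply: contraPT hs => ks; case; exists k.
by rewrite size_enum_ord leqNgt sn.
Qed.

(** The root e_i - e_j is the image of h - e_j - e_k - e_l under the reflection in
    h - e_i - e_k - e_l, so its reflection is a product of three generators. *)
Lemma W_swap i j : i != j -> exists2 g, W g & forall v, g *m v = refl (e i - e j) v.
Proof.
move=> ij; have [|k] := @exists_notin [:: i; j]; first exact: leq_trans hn.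
rewrite !inE negb_or => /andP[ki kj].
have [|l] := @exists_notin [:: i; j; k]; first exact: leq_trans hn.
rewrite !inE !negb_or => /and3P[li lj lk].
have [ik jk il jl kl] : [/\ i != k, j != k, i != l, j != l & k != l].
  by rewrite !(eq_sym _ k) !(eq_sym _ l).
pose r := cremona_mx R i k l; pose s := cremona_mx R j k l.
exists (r * s * r).
  by do ?apply: gen_mul; apply: cremona_mx_gen.
move=> v; rewrite -!mulmxE -!mulmxA !cremona_mxE // refl_conj ?alpha_sq //.
congr (refl _ v); rewrite /refl dot_alpha /alpha.
rewrite !degD !degN !mulD !mulN deg_h !deg_e !mul_h !mul_e !eqxx.
rewrite ?(eq_sym j i) (negPf ij) ?(negPf ki, negPf li, negPf lk, negPf kj, negPf lj).
rewrite ?(negPf kl, negPf ik, negPf jk, negPf il, negPf jl) /=.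
apply: vecP => [|a]; rewrite ?(degD, degN, degZ, mulD, mulN, mulZ); ring.
Qed.

Definition o0 : 'I_n := Ordinal (leq_trans (isT : (0 < 10)%N) hn).
Definition o1 : 'I_n := Ordinal (leq_trans (isT : (1 < 10)%N) hn).
Definition o2 : 'I_n := Ordinal (leq_trans (isT : (2 < 10)%N) hn).

Definition alpha0 : N1 := alpha R o0 o1 o2.

Definition simple_root r :=
  r = alpha0 \/ exists i j, (j = i.+1 :> nat) /\ r = e i - e j.

Lemma succ_neq i j : j = i.+1 :> nat -> i != j.
Proof. by move=> ji; rewrite -val_eqE /= ji neq_ltn ltnSn. Qed.

Lemma simple_exc_diff i j : j = i.+1 :> nat -> simple_root (e i - e j).
Proof. by move=> ij; right; exists i, j. Qed.

Lemma simple_sq r : simple_root r -> dot r r = -2.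
Proof.
case=> [->|[i [j [/succ_neq ij ->]]]]; last exact: exc_diff_sq.
exact: alpha_sq.
Qed.

Lemma simple_K r : simple_root r -> dot r K = 0.
Proof.
by case=> [->|[i [j [_ ->]]]]; rewrite ?alpha_K ?exc_diff_K.
Qed.

Lemma simple_refl r : simple_root r ->
  exists2 g, W g & forall v, g *m v = refl r v.
Proof.
case=> [->|[i [j [/succ_neq ij ->]]]]; last exact: W_swap.
by exists (cremona_mx R o0 o1 o2); [apply: cremona_mx_gen | move=> v; apply: cremona_mxE].
Qed.

End Group.

(** * Action of the Cremona group on curves *)

Section TriangleCoordinates.
Variables (F : fieldType) (n : nat) (A : 'M[F]_3) (T : 'I_3 -> 'I_n).
Hypotheses (Au : A \in unitmx) (T_inj : injective T).

Lemma third_indices (a : 'I_3) : exists b c : 'I_3, [/\ b != a, c != a & b != c].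
Proof.
case: a => [[|[|[|//]]] ha].
- by exists 1, 2%:R; rewrite -!val_eqE.
- by exists 0, 2%:R; rewrite -!val_eqE.
- by exists 0, 1; rewrite -!val_eqE.
Qed.

Lemma coord_col a b : (invmx A *m col b A) a 0 = (a == b)%:R.
Proof. by rewrite colE mulKmx // mxE eqxx andbT. Qed.

Lemma row_mul_eq0 (B : 'M[F]_3) a (p : 'cV[F]_3) :
  (row a B *m p == 0) = ((B *m p) a 0 == 0).
Proof.
rewrite -row_mul; apply/eqP/eqP => [/matrixP/(_ 0 0)|z]; first by rewrite !mxE.
by apply/matrixP => i j; rewrite !ord1 [LHS]mxE z mxE.
Qed.

Lemma side_neq0 a : row a (invmx A) != 0.
Proof.
apply: contraTneq isT => r0; have /eqP := coord_col a a.
rewrite eqxx -[_ a 0]/((invmx A *m col a A) a 0).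
have := row_mul_eq0 (invmx A) a (col a A).
by rewrite r0 mul0mx eqxx => /esym/eqP ->; rewrite eq_sym oner_eq0.
Qed.

(** A point with a vanishing coordinate lies on a side of the triangle. *)
Lemma coord_neq0 (X : 'I_n -> 'cV[F]_3) a l : no_three_collinear X ->
  (forall b, X (T b) = col b A) -> (forall b, l != T b) ->
  (invmx A *m X l) a 0 != 0.
Proof.
move=> ntc XT lT; apply/eqP => z; have [b [c [ba ca bc]]] := third_indices a.
have := ntc l (T b) (T c) (lT b) (lT c).
rewrite (inj_eq T_inj) => /(_ bc); apply; exists (row a (invmx A)).
  exact: side_neq0.
split; apply/eqP; rewrite row_mul_eq0 ?z //.
  by rewrite XT coord_col (eq_sym a) (negPf ba).
by rewrite XT coord_col (eq_sym a) (negPf ca).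
Qed.

End TriangleCoordinates.

Section Curves.
Variables (R : realType) (n : nat).
Hypothesis hn : (9 < n)%N.
Local Notation N1 := 'cV[R]_n.+1.
Local Notation dot := (@intersection R n).
Local Notation h := (line_class R n).
Local Notation e := (@exc R n).
Local Notation K := (canonical_class R n).
Local Notation W := (@cremona_group R n).
Local Notation mult := PlaneCurve.multiplicity.
Implicit Types (u v w r c : N1) (i j k l : 'I_n) (g : 'M[R]_n.+1).
Implicit Types (P Q : 'I_n -> 'cV[R[i]]_3).

Definition plane_class P d f : N1 := d%:R *: h - \sum_(i < n) (mult f (P i))%:R *: e i.

Lemma deg_plane_class P d f : deg (plane_class P d f) = d%:R.
Proof. exact: deg_comb. Qed.

Lemma mul_plane_class P d f i : mul (plane_class P d f) i = (mult f (P i))%:R.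
Proof. exact: mul_comb. Qed.

Lemma plane_classP v P d f : deg v = d%:R ->
  (forall i, mul v i = (mult f (P i))%:R) -> v = plane_class P d f.
Proof.
by move=> vd vm; apply: vecP => [|i]; rewrite ?deg_plane_class ?mul_plane_class.
Qed.

Lemma cremona_iterate_trans P Q Q' :
  cremona_iterate P Q -> cremona_iterate Q Q' -> cremona_iterate P Q'.
Proof.
by move=> PQ; elim=> // Q1 i j k A _ IH ij ik jk Au pi pj pk; apply: cremona_iterateS.
Qed.

Lemma very_general_ntc P : very_general P -> no_three_collinear P.
Proof. by apply; apply: cremona_iterate0. Qed.

Definition triple i j k (a : 'I_3) : 'I_n := nth i [:: i; j; k] a.

Lemma triple_inj i j k : i != j -> i != k -> j != k -> injective (triple i j k).
Proof.
move=> ij ik jk a b /eqP; rewrite /triple nth_uniq ?size_tuple //=.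
  by move/eqP/val_inj.
by rewrite !inE negb_or ij ik jk.
Qed.

Lemma in_triple i j k l : (l \in [:: i; j; k]) = [exists a, l == triple i j k a].
Proof.
apply/idP/existsP => [|[a /eqP ->]]; last by apply: mem_nth; case: a.
rewrite !inE => /or3P[] /eqP ->; [by exists 0|by exists 1|by exists 2%:R].
Qed.

Lemma big_triple (V : nmodType) i j k (E : 'I_n -> V) :
  \sum_a E (triple i j k a) = E i + E j + E k.
Proof. by rewrite !big_ord_recl big_ord0 addr0 addrA. Qed.

Lemma triangle_unit P i j k : no_three_collinear P -> i != j -> i != k -> j != k ->
  exists2 A, A \in unitmx & forall a, P (triple i j k a) = col a A.
Proof.
move=> ntc ij ik jk; pose A := \matrix_(b, a) P (triple i j k a) b 0.
have AE a : P (triple i j k a) = col a A by apply/colP => b; rewrite !mxE.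
exists A => //; rewrite -row_free_unit -kermx_eq0; apply/rowV0P => v /sub_kermxP vA.
apply/eqP; apply: contraTT isT => v0; have := ntc i j k ij ik jk; case.
exists v => //; have vP a : v *m P (triple i j k a) = 0.
  by rewrite AE colE mulmxA vA mul0mx.
by split; [apply: (vP 0) | apply: (vP 1) | apply: (vP 2%:R)].
Qed.

Lemma vertex_arith (d d' x y z : nat) : (2 * d = d' + (x + z))%N -> (y + z = d)%N ->
  x%:R + (d'%:R - d%:R) = y%:R :> R.
Proof.
move=> /(congr1 (fun a : nat => a%:R : R)) E /(congr1 (fun a : nat => a%:R : R)).
by move: E; rewrite natrM !natrD; lra.
Qed.

(** The points T a with a < 3 are the centers, and the columns of A represent
    them. *)
Section Step.
Variables (P : 'I_n -> 'cV[R[i]]_3) (i j k : 'I_n) (A : 'M[R[i]]_3).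
Hypotheses (ij : i != j) (ik : i != k) (jk : j != k) (Au : A \in unitmx).
Let T := triple i j k.
Let Q := cremona_points A i j k P.
Hypothesis PT : forall a, P (T a) = col a A.
Hypotheses (ntcP : no_three_collinear P) (ntcQ : no_three_collinear Q).
Let T_inj : injective T := triple_inj ij ik jk.

Lemma deg_alpha : deg (alpha R i j k) = 1.
Proof. by rewrite /alpha !degD !degN deg_h !deg_e !subr0. Qed.

Lemma mul_alphaT l : mul (alpha R i j k) l = \sum_a (T a == l)%:R.
Proof.
rewrite (big_triple i j k (fun x => (x == l)%:R)).
by rewrite /alpha !mulD !mulN mul_h !mul_e !opprK add0r.
Qed.

Lemma mul_alpha_in a : mul (alpha R i j k) (T a) = 1.
Proof.
rewrite mul_alphaT (bigD1 a) //= eqxx big1 ?addr0 // => b ba.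
by rewrite (inj_eq T_inj) (negPf ba).
Qed.

Lemma mul_alpha_out l : (forall a, l != T a) -> mul (alpha R i j k) l = 0.
Proof.
by move=> lT; rewrite mul_alphaT big1 // => a _; rewrite eq_sym (negPf (lT a)).
Qed.

Lemma dot_alphaT v : dot v (alpha R i j k) = deg v - \sum_a mul v (T a).
Proof.
by rewrite (big_triple i j k (mul v)) dot_alpha !opprD !addrA.
Qed.

Lemma in_or_out l : (exists a, l = T a) \/ (forall a, l != T a).
Proof.
have [/existsP [a /eqP ->]|/existsPn lT] := boolP [exists a, l == T a].
  by left; exists a.
by right.
Qed.

Lemma QT a : Q (T a) = col a A.
Proof. by rewrite /Q /cremona_points in_triple ifT ?PT //; apply/existsP; exists a. Qed.

Lemma Q_out l : (forall a, l != T a) -> Q l = quadratic_map A (P l).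
Proof.
by move=> lT; rewrite /Q /cremona_points in_triple ifF //; apply/negbTE/existsPn.
Qed.

(** A side contains two of the centers and, as no three points are collinear, no
    other point. It serves twice: the side itself is contracted to the
    exceptional curve over the opposite vertex in one direction, and is the image of
    that curve in the other. *)
Lemma side_class X f a : no_three_collinear X -> (forall b, X (T b) = col b A) ->
  (forall p, mult f p = ((invmx A *m p) a 0%R == 0) :> nat) ->
  plane_class X 1 f = refl (alpha R i j k) (e (T a)).
Proof.
move=> ntc XT mf; apply: vecP => [|l].
  by rewrite deg_plane_class deg_refl deg_e add0r dotC dot_e mul_alpha_in mul1r deg_alpha.
rewrite mul_plane_class mf mul_refl mul_e dotC dot_e mul_alpha_in mul1r.
have [[b ->]|lT] := in_or_out l.
  rewrite XT coord_col // mul_alpha_in (inj_eq T_inj).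
  by case: (a == b); rewrite ?oner_eq0 ?eqxx /= ?addNr ?oppr0 ?add0r.
rewrite mul_alpha_out // (eq_sym (T a)) (negPf (lT a)) oppr0 addr0.
by rewrite (negPf (coord_neq0 Au T_inj _ ntc XT lT)).
Qed.

(** The three kinds of curves are the exceptional ones (fixed, or mapped to sides of
    the triangle of the transformed points), the sides of the triangle, which
    are contracted, and the curves with a strict transform. *)
Lemma cremona_curve_class c : curve_class P c ->
  curve_class Q (cremona_mx R i j k *m c).
Proof.
rewrite cremona_mxE //; case=> [l|d f fd fi].
  have [[a ->]|lT] := in_or_out l; last first.
    rewrite /refl dotC dot_e mul_alpha_out // scale0r addr0.
    exact: exceptional_curve.
  pose f := PlaneForms.line (row a (invmx A)).
  have f0 : row a (invmx A) != 0 by apply: side_neq0.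
  rewrite -(@side_class Q f) //; last first.
  - by move=> p; rewrite PlaneForms.mult_line // row_mul_eq0.
  - exact: QT.
  have fh : PlaneCurve.form_of_degree 1 f by apply: PlaneForms.lin_form_homog.
  apply: strict_transform => //.
  by apply: PlaneForms.homog1_irreducible => //; apply: PlaneForms.line_neq0.
rewrite -/(plane_class P d f).
have [[a d1 mf]|[d' [g [gd gi dE gT gout]]]] := PlaneForms.cremona_curve Au fd fi.
  rewrite d1 (@side_class P f a) // reflK ?alpha_sq //.
  exact: exceptional_curve.
have dotc : dot (plane_class P d f) (alpha R i j k) = d'%:R - d%:R.
  rewrite dot_alphaT deg_plane_class.
  have -> : \sum_a mul (plane_class P d f) (T a) = (\sum_a mult f (col a A))%:R :> R.
    by rewrite natr_sum; apply: eq_bigr => a _; rewrite mul_plane_class PT.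
  have /(congr1 (fun x : nat => x%:R : R)) := dE.
  by rewrite natrD natrM => E; lra.
have cm := mul_plane_class P d f; have cd := deg_plane_class P d f.
move: (plane_class P d f) cd cm dotc => c' cd cm dotc.
rewrite (@plane_classP (refl (alpha R i j k) c') Q d' g); first exact: strict_transform.
  rewrite deg_refl deg_alpha dotc cd; ring.
move=> l; rewrite mul_refl dotc cm.
have [[a ->]|lT] := in_or_out l; last first.
  rewrite (mul_alpha_out lT) mulr0 addr0; apply: (congr1 (fun x : nat => x%:R)).
  apply/esym; apply: etrans (congr1 (mult g) (Q_out lT)) _; apply: gout => a.
  exact: (coord_neq0 Au T_inj _ ntcP PT lT).
rewrite mul_alpha_in mulr1.
have -> : mult g (Q (T a)) = mult g (col a A) by apply: congr1; apply: QT.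
rewrite PT.
have dEa := dE; rewrite (bigD1 a) //= in dEa.
exact: vertex_arith dEa (gT a).
Qed.

End Step.

(** As iterates of the transformed points are iterates of P, they are again very
    general. *)
Lemma forward_step P i j k : very_general P -> i != j -> i != k -> j != k ->
  exists2 Q, very_general Q &
    forall c, curve_class P c -> curve_class Q (cremona_mx R i j k *m c).
Proof.
move=> vg ij ik jk; have ntc := very_general_ntc vg.
have [A Au PA] := triangle_unit ntc ij ik jk.
have PQ : cremona_iterate P (cremona_points A i j k P).
  by apply: cremona_iterateS => //; [exact: cremona_iterate0|..];
    exists 1; rewrite ?oner_eq0 // scale1r -PA.
have vgQ : very_general (cremona_points A i j k P).
  by move=> Q QQ; apply: vg; apply: cremona_iterate_trans QQ.
exists (cremona_points A i j k P) => // c.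
by apply: cremona_curve_class => //; apply: very_general_ntc.
Qed.

Lemma forward P g : very_general P -> W g ->
  exists2 Q, very_general Q & forall c, curve_class P c -> curve_class Q (g *m c).
Proof.
move=> vg; move: g; apply: cremona_group_ind => [|i j k g ij ik jk _ [Q vgQ PQ]].
  by exists P => // c; rewrite mul1mx.
have [Q' vgQ' QQ'] := forward_step vgQ ij ik jk.
by exists Q' => // c /PQ/QQ'; rewrite -mulmxE mulmxA.
Qed.

Lemma curve_deg_mul P c : curve_class P c ->
  (exists i, c = e i) \/
  (exists d (m : 'I_n -> nat),
     [/\ deg c = d%:R, forall i, mul c i = (m i)%:R & forall i, (m i <= d)%N]).
Proof.
case=> [i|d f fd fi]; first by left; exists i.
right; exists d, (fun i => mult f (P i)); rewrite -/(plane_class P d f).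
split=> [|i|i]; rewrite ?deg_plane_class ?mul_plane_class //.
by apply: PlaneForms.mult_le_deg => //; case: fi.
Qed.

Lemma curve_integral P c : curve_class P c -> integral c.
Proof.
case/curve_deg_mul => [[i ->]|[d [m [dE mE _]]]]; first exact: integral_e.
by split=> [|i]; rewrite ?dE ?mE natr_int.
Qed.

Lemma curve_deg_ge0 P c : curve_class P c -> 0 <= deg c.
Proof.
by case/curve_deg_mul => [[i ->]|[d [m [-> _ _]]]]; rewrite ?deg_e ?ler0n.
Qed.

End Curves.

Import (canonicals) mpoly.
(** * The fundamental chamber is nef and effective *)

Section ConeHull.
Variables (R : realType) (m : nat).
Implicit Types (X : set 'cV[R]_m) (v w : 'cV[R]_m).

Lemma cone_hull_mem X v : X v -> cone_hull X v.
Proof.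
move=> Xv; exists 1%N, (fun=> 1), (fun=> v); split=> //.
by rewrite big_ord1 scale1r.
Qed.

Lemma cone_hull0 X : cone_hull X 0.
Proof.
exists 0%N, (fun=> 0), (fun=> 0); split=> [i|[]|] //.
by rewrite big_ord0.
Qed.

Lemma cone_hullD X v w : cone_hull X v -> cone_hull X w -> cone_hull X (v + w).
Proof.
move=> [k [a [x [a0 xX ->]]]] [l [b [y [b0 yX ->]]]].
exists (k + l)%N,
  (fun i : 'I_(k + l) => match fintype.split i with inl j => a j | inr j => b j end),
  (fun i : 'I_(k + l) => match fintype.split i with inl j => x j | inr j => y j end).
split=> [i|i|].
- by case: fintype.split.
- by case: fintype.split.
- rewrite big_split_ord; congr (_ + _); apply: eq_bigr => i _.
    by rewrite (unsplitK (inl i)).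
  by rewrite (unsplitK (inr i)).
Qed.

Lemma cone_hullZ X c v : 0 <= c -> cone_hull X v -> cone_hull X (c *: v).
Proof.
move=> c0 [k [a [x [a0 xX ->]]]]; exists k, (fun i => c * a i), x; split=> // [i|].
  exact: mulr_ge0.
by rewrite scaler_sumr; apply: eq_bigr => i _; rewrite scalerA.
Qed.

Lemma cone_hull_sum X (I : finType) (E : I -> 'cV[R]_m) :
  (forall i, cone_hull X (E i)) -> cone_hull X (\sum_i E i).
Proof.
move=> hE; elim/big_rec: _ => [|i v _ hv]; first exact: cone_hull0.
exact: cone_hullD.
Qed.

Lemma cone_hull_ind X (Q : 'cV[R]_m -> Prop) : Q 0 ->
  (forall v w, Q v -> Q w -> Q (v + w)) -> (forall c v, 0 <= c -> Q v -> Q (c *: v)) ->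
  (forall v, X v -> Q v) -> forall v, cone_hull X v -> Q v.
Proof.
move=> Q0 QD QZ QX v [k [a [x [a0 xX ->]]]].
by elim/big_rec: _ => // i w _ Qw; apply: QD => //; apply: QZ => //; apply: QX.
Qed.

End ConeHull.

Section Chamber.
Variables (R : realType) (n : nat).
Hypothesis hn : (9 < n)%N.
Local Notation N1 := 'cV[R]_n.+1.
Local Notation dot := (@intersection R n).
Local Notation h := (line_class R n).
Local Notation e := (@exc R n).
Local Notation K := (canonical_class R n).
Local Notation W := (@cremona_group R n).
Local Notation simple_root := (@simple_root R n hn).
Local Notation o0 := (o0 hn).
Local Notation o1 := (o1 hn).
Local Notation o2 := (o2 hn).
Implicit Types (u v w r c : N1) (i j k l : 'I_n) (g : 'M[R]_n.+1).
Implicit Types (P Q : 'I_n -> 'cV[R[i]]_3).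

(** On vectors with decreasing m_i the last condition only says that m_(n-1) >= 0. It
    is stated for all i because the e_i are curves. *)
Definition dominant v := (forall r, simple_root r -> 0 <= dot v r) /\ forall i, 0 <= mul v i.

Definition chamber : set N1 := [set v | dominant v /\ dot v K <= 0].

Lemma dominant_deg v : dominant v -> mul v o0 + mul v o1 + mul v o2 <= deg v.
Proof.
move=> [/(_ (alpha0 R hn)) hv _]; have := hv (or_introl erefl).
rewrite dot_alpha; lra.
Qed.

Lemma dominant_sorted v i j : dominant v -> (i <= j)%N -> mul v j <= mul v i.
Proof.
move=> [hv _] ij; have [k kE] : exists k : nat, j = (i + k)%N :> nat by exists (j - i)%N; lia.
elim: k i {ij} kE => [|k IHk] i kE.
  by have -> : j = i by apply: val_inj; rewrite /= kE addn0.
have i1n : (i.+1 < n)%N by apply: leq_ltn_trans (ltn_ord j); lia.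
apply: (@le_trans _ _ (mul v (Ordinal i1n))); first by apply: IHk => /=; lia.
have := hv (e i - e (Ordinal i1n))
  (simple_exc_diff R hn (i := i) (j := Ordinal i1n) erefl).
by rewrite dot_exc_diff subr_ge0.
Qed.

Lemma sum_split3 (E : 'I_n -> R) : \sum_i E i =
  E o0 + E o1 + E o2 + \sum_(i < n | (2 < i)%N) E i.
Proof.
rewrite (bigID (fun i : 'I_n => (2 < i)%N)) /= addrC; congr (_ + _).
rewrite (bigD1 o0) //= (bigD1 o1) //= (bigD1 o2) //= big1 ?addr0 ?addrA // => i.
by rewrite -!val_eqE /=; case: (i : nat) => [|[|[|]]].
Qed.

(** Noether's inequality, in bilinear form. For i > 2 the products m_i(v) m_i(c) are
    bounded by m_i(v) m_2(c), and the sum of these m_i(v) is bounded because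
    v.K <= 0; the rest follows from d >= m_0 + m_1 + m_2 for c. *)
Lemma dominant_dot v c : chamber v -> dominant c -> 0 <= dot v c.
Proof.
move=> [dv vK] dc; rewrite dotE; move: vK; rewrite dot_K => vK.
have s01 := @dominant_sorted v o0 o1 dv isT; have s12 := @dominant_sorted v o1 o2 dv isT.
have t01 := @dominant_sorted c o0 o1 dc isT; have t12 := @dominant_sorted c o1 o2 dc isT.
have p2 := dv.2 o2; have q2 := dc.2 o2.
have dd := dominant_deg dv; have ee := dominant_deg dc.
have tail : \sum_(i < n | (2 < i)%N) mul v i * mul c i <=
    (3 * deg v - mul v o0 - mul v o1 - mul v o2) * mul c o2.
  apply: (@le_trans _ _ (\sum_(i < n | (2 < i)%N) mul v i * mul c o2)).
    apply: ler_sum => i i2; apply: ler_wpM2l; first exact: dv.2.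
    by apply: dominant_sorted => //=; lia.
  rewrite -mulr_suml; apply: ler_wpM2r => //.
  by move: vK; rewrite sum_split3; lra.
rewrite sum_split3.
have a1 : 0 <= (deg v - mul v o0) * (mul c o0 - mul c o2) by apply: mulr_ge0; lra.
have a2 : 0 <= (deg v - mul v o1) * (mul c o1 - mul c o2) by apply: mulr_ge0; lra.
have a3 : 0 <= deg v * (deg c - mul c o0 - mul c o1 - mul c o2) by apply: mulr_ge0; lra.
lra.
Qed.

(** A class that is positive on the simple roots and, because its degree is at least
    the sum of its multiplicities, nonnegative on all curves. *)
Definition rho : N1 := (n ^ 2)%:R *: h - \sum_(i < n) (n - i)%:R *: e i.

Lemma deg_rho : deg rho = (n ^ 2)%:R.
Proof. exact: deg_comb. Qed.

Lemma mul_rho i : mul rho i = (n - i)%:R.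
Proof. exact: mul_comb. Qed.

Lemma rho_strict r : simple_root r -> 0 < dot rho r.
Proof.
case=> [->|[i [j [ij ->]]]]; last first.
  by rewrite dot_exc_diff !mul_rho subr_gt0 ltr_nat; have := ltn_ord j; lia.
rewrite dot_alpha deg_rho !mul_rho -!addrA -!opprD subr_gt0 -!natrD ltr_nat /=.
by move: hn; nia.
Qed.

Lemma rho_chamber : chamber rho.
Proof.
split; first by split=> [r /rho_strict/ltW|i] //; rewrite mul_rho ler0n.
rewrite dot_K deg_rho subr_le0.
apply: (@le_trans _ _ (\sum_(i < n) n%:R)).
  by apply: ler_sum => i _; rewrite mul_rho ler_nat leq_subr.
rewrite sumr_const card_ord -mulrnA -natrM ler_nat.
by rewrite expnS expn1; nia.
Qed.

Lemma rho_integral : integral rho.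
Proof. by split=> [|i]; rewrite ?deg_rho ?mul_rho natr_int. Qed.

Lemma rho_curve (P : 'I_n -> 'cV[R[i]]_3) c : curve_class P c -> 0 <= dot rho c.
Proof.
case/curve_deg_mul => [[i ->]|[d [m [dE mE md]]]]; first by rewrite dot_e mul_rho ler0n.
rewrite dotE deg_rho dE subr_ge0.
apply: (@le_trans _ _ (\sum_(i < n) (n * d)%:R)).
  apply: ler_sum => i _; rewrite mul_rho mE -natrM ler_nat.
  by apply: leq_mul => //; apply: leq_subr.
by rewrite sumr_const card_ord -mulrnA -natrM ler_nat expnS expn1; lia.
Qed.

Lemma rho_curve_nat (P : 'I_n -> 'cV[R[i]]_3) c : curve_class P c ->
  exists N : nat, dot rho c = N%:R.
Proof.
move=> cP; apply/natrP; rewrite natrEint (rho_curve cP) andbT.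
by apply: integral_dot; [apply: rho_integral | apply: curve_integral cP].
Qed.

Lemma curve_refl P c r : very_general P -> curve_class P c -> simple_root r ->
  exists2 Q, very_general Q & curve_class Q (refl r c).
Proof.
move=> vg cP /simple_refl [g Wg gE]; have [Q vgQ PQ] := forward vg Wg.
by exists Q => //; rewrite -gE; apply: PQ.
Qed.

(** Reflections in simple roots meeting a curve negatively decrease its
    intersection with rho, a nonnegative integer, until the class of the curve
    is exceptional or dominant. *)
Lemma curve_descent (T : N1 -> Prop) :
  (forall i, T (e i)) ->
  (forall c, integral c -> dominant c -> T c) ->
  (forall c r, (forall i, c != e i) -> simple_root r -> dot c r < 0 ->
     T (refl r c) -> T c) ->
  forall P c, very_general P -> curve_class P c -> T c.
Proof.
move=> Te Td Tr P c vg cP; have [N cN] := rho_curve_nat cP.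
elim/ltn_ind: N P c vg cP cN => N IHN P c vg cP cN.
have [[i ->]|[d [m [dE mE md]]]] := curve_deg_mul cP; first exact: Te.
have [/existsP [i /eqP ->]|/existsPn ne] := boolP [exists i, c == e i]; first exact: Te.
case: (EM (exists2 r, simple_root r & dot c r < 0)) => [[r sr cr]|nr].
  apply: (Tr _ r) => //; have [Q vgQ cQ] := curve_refl vg cP sr.
  have [M cM] := rho_curve_nat cQ; apply: (IHN M _ _ _ vgQ cQ cM).
  rewrite -(ltr_nat R) -cM -cN /refl dotDr dotZr gtrDl.
  by rewrite nmulr_rlt0 // rho_strict.
apply: Td; first exact: curve_integral cP.
split=> [r sr|i]; last by rewrite mE ler0n.
by rewrite leNgt; apply/negP => cr; case: nr; exists r.
Qed.

Lemma dot_refl_le v c r : simple_root r -> 0 <= dot v r -> dot c r <= 0 ->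
  dot v (refl r c) <= dot v c.
Proof.
by move=> sr vr cr; rewrite /refl dotDr dotZr gerDl mulr_le0_ge0.
Qed.

Lemma chamber_nef P v : very_general P -> chamber v -> Nef P v.
Proof.
move=> vg cv c cP.
apply: (curve_descent (T := fun c => 0 <= dot v c) _ _ _ vg cP) => {c cP} [i|c _|c r _ sr cr].
- by rewrite dot_e; case: cv => -[].
- exact: dominant_dot.
- move=> h0; apply: le_trans h0 _; apply: dot_refl_le => //; last exact: ltW.
  by case: cv => -[+ _] _; apply.
Qed.

Lemma Nef_Eff P v w : Nef P v -> Eff P w -> 0 <= dot v w.
Proof.
move=> nv; move: w; apply: cone_hull_ind => [|u w hu hw|c w c0 hw|w]; last exact: nv.
- by rewrite dotC dot0l.
- by rewrite dotDr addr_ge0.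
- by rewrite dotZr mulr_ge0.
Qed.

Lemma plane_classM P d d' (f f' : mpoly.mpoly 3 R[i]) : f != 0 -> f' != 0 ->
  plane_class P d f + plane_class P d' f' = plane_class P (d + d') (f * f').
Proof.
move=> f0 f'0; apply: plane_classP => [|i].
  rewrite natrD; apply: etrans (degD _ _) _.
  by apply: f_equal2; apply: deg_plane_class.
rewrite PlaneForms.multM // natrD; apply: etrans (mulD _ _ _) _.
by apply: f_equal2; apply: mul_plane_class.
Qed.

(** The class is additive in the form, so it is the sum of the classes of the
    irreducible factors. *)
Lemma form_Eff P d (f : mpoly.mpoly 3 R[i]) : f != 0 -> PlaneCurve.form_of_degree d f ->
  Eff P (plane_class P d f).
Proof.
move: d f; apply: PlaneForms.form_ind => [c c0|d f fd fi|d d' f f' f0 f'0 hf hf'].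
- rewrite /plane_class scale0r big1 ?subr0 => [|i _]; first exact: cone_hull0.
  by rewrite PlaneForms.multC scale0r.
- by apply: cone_hull_mem; apply: strict_transform.
- by rewrite -(plane_classM P d d' f0 f'0); exact: (cone_hullD hf hf').
Qed.

Lemma bin2_double m : ('C(m.+1, 2) * 2 = m.+1 * m)%N.
Proof.
elim: m => [|m IHm] //; rewrite binS bin1 mulnDl IHm; lia.
Qed.

(** Riemann-Roch in the form of a parameter count: forms of degree d depend on
    (d + 1)(d + 2)/2 coefficients, and the condition at P_i is at most
    m (m + 1)/2 linear equations. *)
Lemma integral_Eff P v : (forall i, P i != 0) -> integral v -> 0 <= deg v ->
  dot v K <= dot v v -> Eff P v.
Proof.
move=> P0 [vd vm] d0 hK.
have /natrP [d dE] : deg v \is a Num.nat by rewrite natrEint vd d0.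
(* Negative multiplicities impose no condition: they are replaced by zero. *)
have /choice [m hm] i : exists m : nat, mul v i <= m%:R /\
    (m%:R * (m%:R + 1) <= mul v i * (mul v i + 1) :> R).
  have /intrP [z zE] := vm i; rewrite zE; case: z {zE} => k.
    by exists k.
  exists 0%N; rewrite mul0r NegzE; split; first by rewrite lerz0.
  rewrite intrN -pmulrn -natr1; have : (0 : R) <= k%:R by apply: ler0n.
  by nra.
have [|f [f0 fd fm]] := PlaneForms.form_with_multiplicities (d := d) (m := m) P0.
  rewrite -(ltn_pmul2r (isT : (0 < 2)%N)) bin2_double big_distrl /=.
  under eq_bigr do rewrite bin2_double.
  rewrite -(ltr_nat R) natr_sum natrM.
  have : \sum_(i < n) ((m i).+1 * m i)%:R <= \sum_(i < n) (mul v i ^+ 2 + mul v i).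
    by apply: ler_sum => i _; rewrite natrM mulrC -natr1; have [_] := hm i; nra.
  rewrite big_split /= -!natr1 -dE; move: hK; rewrite dot_K dotE.
  have -> : \sum_(i < n) mul v i * mul v i = \sum_(i < n) mul v i ^+ 2.
    by apply: eq_bigr => i _; rewrite expr2.
  by nra.
have -> : v = plane_class P d f +
    \sum_i ((PlaneCurve.multiplicity f (P i))%:R - mul v i) *: e i.
  apply: vecP => [|i].
    rewrite degD deg_plane_class deg_sum big1 ?addr0 // => j _.
    by rewrite degZ deg_e mulr0.
  rewrite mulD mul_plane_class mul_sum (bigD1 i) //= mulZ mul_e eqxx big1 => [|j ji].
    by rewrite /=; ring.
  by rewrite mulZ mul_e (negPf ji) oppr0 mulr0.
apply: cone_hullD; first exact: form_Eff.
apply: cone_hull_sum => i; apply: cone_hullZ; last first.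
  by apply: cone_hull_mem; apply: exceptional_curve.
by rewrite subr_ge0; apply: le_trans (hm i).1 _; rewrite ler_nat.
Qed.

Section Action.
Variable P : 'I_n -> 'cV[R[i]]_3.
Hypotheses (P0 : forall i, P i != 0) (vg : very_general P).

Lemma line_Eff : Eff P h.
Proof.
apply: integral_Eff => //; first exact: integral_h.
  by rewrite deg_h.
by rewrite (dotC h K) !dot_h deg_h deg_K; lra.
Qed.

(** Equality holds in the inequality of integral_Eff, as both sides are -1. *)
Lemma W_exc_Eff g i : W g -> Eff P (g *m e i).
Proof.
move=> Wg; apply: integral_Eff => //; first by apply: W_integral => //; apply: integral_e.
  have [Q vgQ PQ] := forward vg Wg.
  by apply: (@curve_deg_ge0 _ _ Q); apply: PQ; apply: exceptional_curve.
by rewrite W_dotK // W_dot // dotC !dot_e mul_K mul_e eqxx.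
Qed.

(** On the blowup at P the intersections of g v with curves are those of v with
    curves on another blowup. *)
Lemma W_chamber_Nef g v : W g -> chamber v -> Nef P (g *m v).
Proof.
move=> Wg cv c cP; rewrite W_adj //; have Wg1 : W g^-1 by apply: gen_inv.
have [Q vgQ PQ] := forward vg Wg1.
by apply: (chamber_nef vgQ cv); apply: PQ.
Qed.

Lemma W_integral_Eff g v : W g -> chamber v -> integral v -> Eff P (g *m v).
Proof.
move=> Wg cv iv; apply: integral_Eff => //; first exact: W_integral.
  by rewrite -dot_h; apply: (@Nef_Eff P); [apply: W_chamber_Nef | apply: line_Eff].
rewrite W_dotK // W_dot //; case: (cv) => dv vK; apply: le_trans vK _.
exact: dominant_dot.
Qed.

End Action.
End Chamber.

(** * Every orbit meets the chamber *)

Section WeightedMinimum.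
Variable R : realType.

(** Only the coordinates with nonzero weight matter, and those of small value
    are bounded, so finitely many tuples compete. *)
Lemma weighted_sum_attains_min k (a : 'I_k -> R) (S : ('I_k -> nat) -> Prop) s0 :
  (forall i, 0 <= a i) -> S s0 ->
  exists2 s, S s & forall s', S s' -> \sum_i a i * (s i)%:R <= \sum_i a i * (s' i)%:R.
Proof.
move=> a0 Ss0; pose val (s : 'I_k -> nat) := \sum_i a i * (s i)%:R.
have [M hM] : exists M : nat, forall i, a i != 0 -> val s0 / a i <= M%:R.
  have /choice [m hm] i : exists m : nat, val s0 / a i <= m%:R.
    have [m hm] : exists m : nat, `|val s0 / a i| < m%:R.
      by exists (Num.bound `|val s0 / a i|); apply: archi_boundP.
    by exists m; apply: le_trans (ler_norm _) (ltW hm).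
  exists (\max_i m i)%N => i _; apply: le_trans (hm i) _.
  by rewrite ler_nat; apply: leq_bigmax.
pose box := {ffun 'I_k -> 'I_M.+1}.
pose agrees (x : box) (s : 'I_k -> nat) := forall i, a i != 0 -> s i = x i :> nat.
have val_agrees x s : agrees x s -> val s = val (fun i => x i).
  move=> xs; apply: eq_bigr => i _; have [->|ai] := eqVneq (a i) 0; first by rewrite !mul0r.
  by rewrite xs.
have boxed s : S s -> val s <= val s0 -> exists x : box, agrees x s.
  move=> Ss vs; exists [ffun i => inord (s i)] => i ai; rewrite ffunE inordK // ltnS.
  rewrite -(ler_nat R); apply: le_trans (hM _ ai).
  have ai0 : 0 < a i by rewrite lt_def ai a0.
  rewrite ler_pdivlMr // mulrC; apply: le_trans vs.
  rewrite /val (bigD1 i) //= lerDl; apply: sumr_ge0 => j _.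
  by rewrite mulr_ge0 // ler0n.
have [x0 x0s] := boxed s0 Ss0 (lexx _).
pose p (x : box) := `[< exists2 s, S s & agrees x s >].
have px0 : p x0 by apply/asboolP; exists s0.
have [x /asboolP [s Ss xs] min] :=
  Order.TotalTheory.arg_minP (fun x : box => val (fun i => x i)) px0.
exists s => // s' Ss'; rewrite -!/(val _) (val_agrees _ _ xs).
have [le0|lt0] := leP (val s') (val s0); last first.
  by apply: le_trans (ltW lt0); rewrite (val_agrees _ _ x0s); apply: min.
have [x' x's] := boxed s' Ss' le0.
by rewrite (val_agrees _ _ x's); apply: min; apply/asboolP; exists s'.
Qed.

End WeightedMinimum.

Section Orbits.
Variables (R : realType) (n : nat).
Hypothesis hn : (9 < n)%N.
Local Notation N1 := 'cV[R]_n.+1.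
Local Notation dot := (@intersection R n).
Local Notation h := (line_class R n).
Local Notation e := (@exc R n).
Local Notation K := (canonical_class R n).
Local Notation W := (@cremona_group R n).
Local Notation simple_root := (@simple_root R n hn).
Local Notation chamber := (@chamber R n hn).
Local Notation dominant := (@dominant R n hn).
Local Notation rho := (rho R n).
Local Notation o0 := (o0 hn).
Local Notation o1 := (o1 hn).
Local Notation o2 := (o2 hn).
Implicit Types (u v w r c x y : N1) (i j k l : 'I_n) (g : 'M[R]_n.+1).
Implicit Types (P Q : 'I_n -> 'cV[R[i]]_3).

(** An effective class is a nonnegative combination of curves, which remain
    curves under W, so its intersection with rho attains its minimum on the
    orbit; there every simple root is nonnegative. *)
Lemma Nef_e_chamber P v : (forall i, P i != 0) -> very_general P ->
  Nef_e_Kle0 P v -> exists2 g, W g & chamber (g *m v).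
Proof.
move=> P0 vg [[nv [k [a [x [a0 xP vE]]]]] vK].
pose S (s : 'I_k -> nat) := exists2 g, W g & forall q, dot rho (g *m x q) = (s q)%:R.
have S_of g : W g -> exists2 s, S s & forall q, dot rho (g *m x q) = (s q)%:R.
  move=> Wg; have [Q vgQ PQ] := forward vg Wg.
  have hN q : exists N : nat, dot rho (g *m x q) = N%:R.
    exact: rho_curve_nat (PQ _ (xP q)).
  have [s hs] := choice hN.
  by exists s => //; exists g.
have rhoE g s : (forall q, dot rho (g *m x q) = (s q)%:R) ->
    dot rho (g *m v) = \sum_q a q * (s q)%:R.
  move=> hs; rewrite vE mulmx_sumr dot_sumr; apply: eq_bigr => i _.
  by rewrite -scalemxAr dotZr hs.
have [s0 Ss0 _] := S_of 1 (gen_one _).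
have [s [g Wg gs] smin] := weighted_sum_attains_min a0 Ss0.
exists g => //; split; last by rewrite W_dotK.
split=> [r sr|i]; last first.
  rewrite -dot_e W_adj //; apply: (Nef_Eff nv); apply: W_exc_Eff => //.
  exact: gen_inv.
have [t Wt tE] := simple_refl sr.
have Wtg : W (t * g) by apply: gen_mul.
have [s' Ss' hs'] := S_of _ Wtg.
have := smin _ Ss'; rewrite -(rhoE _ _ gs) -(rhoE _ _ hs').
rewrite -mulmxE -mulmxA tE /refl dotDr dotZr lerDl.
by rewrite pmulr_lge0 // rho_strict.
Qed.

Definition strict v := forall r, simple_root r -> 0 < dot v r.

Lemma strict_sorted v i j : dominant v -> strict v -> (i < j)%N -> mul v j < mul v i.
Proof.
move=> dv sv ij; have i1n : (i.+1 < n)%N by apply: leq_ltn_trans (ltn_ord j).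
apply: (@le_lt_trans _ _ (mul v (Ordinal i1n))); first exact: dominant_sorted.
have := sv (e i - e (Ordinal i1n))
  (simple_exc_diff R hn (i := i) (j := Ordinal i1n) erefl).
by rewrite dot_exc_diff subr_gt0.
Qed.

Lemma refl_exc_diff i j l : i != j -> exists m, refl (e i - e j) (e l) = e m.
Proof.
move=> ij; rewrite /refl dot_exc_diff !mul_e.
have [->|li] := eqVneq l i.
  by exists j; rewrite (negPf ij) oppr0 subr0 scaleN1r opprB addrC subrK.
have [->|lj] := eqVneq l j; last by exists l; rewrite subrr scale0r addr0.
by exists i; rewrite oppr0 sub0r opprK scale1r addrC subrK.
Qed.

Lemma refl_alpha0_exc l : (2 < l)%N -> refl (alpha0 R hn) (e l) = e l.
Proof.
move=> l2; rewrite /refl dot_alpha deg_e !mul_e -!val_eqE /=.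
have -> : (l == 0 :> nat) = false by lia.
have -> : (l == 1 :> nat) = false by lia.
have -> : (l == 2 :> nat) = false by lia.
by rewrite !(oppr0, addr0, scale0r).
Qed.

(** The descent of a (-1)-curve other than an e_i ends with a reflection in
    h - e_0 - e_1 - e_2, which reaches e_0, e_1 or e_2. *)
Lemma exceptional_min v P c : chamber v -> very_general P -> curve_class P c ->
  dot c c = -1 -> dot c K = -1 -> (forall i, c != e i) ->
  mul v o2 <= dot v c /\ (strict v -> mul v o2 < dot v c).
Proof.
move=> cv vg cP.
apply: (curve_descent (hn := hn) (T := fun c => dot c c = -1 -> dot c K = -1 ->
  (forall i, c != e i) -> mul v o2 <= dot v c /\ (strict v -> mul v o2 < dot v c))
  _ _ _ vg cP) => {c P vg cP} [i _ _ /(_ i)|c _ dc cc cK _|c r ne sr cr IH cc cK _].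
- by rewrite eqxx.
- have : chamber c by split=> //; rewrite cK; lra.
  by move=> /(dominant_dot)/(_ dc); rewrite cc; lra.
have rr := simple_sq sr.
have le_r : mul v o2 <= dot v (refl r c).
  case: (EM (exists l, refl r c = e l)) => [[l lE]|nl]; last first.
    apply: (IH _ _ _).1 => [||i]; first by rewrite dot_refl.
      by rewrite /refl dotDl dotZl (simple_K sr) mulr0 addr0.
    by apply/eqP => E; case: nl; exists i.
  rewrite lE dot_e; apply: (dominant_sorted cv.1) => /=.
  rewrite leqNgt; apply/negP => l2.
  have cE : c = refl r (e l) by rewrite -lE reflK.
  case: sr => [rE|[i [j [/succ_neq ij rE]]]].
    by have := ne l; rewrite cE rE refl_alpha0_exc // eqxx.
  by have [m mE] := refl_exc_diff l ij; have := ne m; rewrite cE rE mE eqxx.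
have E : dot v c = dot v (refl r c) - dot c r * dot v r.
  by rewrite /refl dotDr dotZr addrK.
split=> [|sv]; rewrite E.
  apply: le_trans le_r _; rewrite lerDl oppr_ge0; apply: mulr_le0_ge0; first exact: ltW.
  by case: cv => -[+ _] _; apply.
by apply: le_lt_trans le_r _; rewrite ltrDl oppr_gt0 nmulr_rlt0 // sv.
Qed.

End Orbits.

(** * Orbits meet the open chamber at most once *)

Section SimpleTransitivity.
Variables (R : realType) (n : nat).
Hypothesis hn : (9 < n)%N.
Local Notation N1 := 'cV[R]_n.+1.
Local Notation dot := (@intersection R n).
Local Notation h := (line_class R n).
Local Notation e := (@exc R n).
Local Notation K := (canonical_class R n).
Local Notation W := (@cremona_group R n).
Local Notation chamber := (@chamber R n hn).
Local Notation strict := (@strict R n hn).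
Local Notation o0 := (o0 hn).
Local Notation o1 := (o1 hn).
Local Notation o2 := (o2 hn).
Implicit Types (u v w r c x y : N1) (i j k l : 'I_n) (g : 'M[R]_n.+1).
Implicit Types (P Q : 'I_n -> 'cV[R[i]]_3).

Lemma dot_exc_image g i j : W g -> dot (g *m e i) (g *m e j) = - (i == j)%:R.
Proof. by move=> Wg; rewrite W_dot // dot_e mul_e. Qed.

Section AtGeneralPoints.
Variable P : 'I_n -> 'cV[R[i]]_3.
Hypothesis vg : very_general P.

(** If g e_k is another e_l, then l < k, so the multiplicities of v decrease from l
    to k; otherwise exceptional_min applies. *)
Lemma exc_image_min v g k : chamber v -> W g -> (1 < k)%N ->
  (forall l, (k < l)%N -> g *m e l = e l) ->
  mul v k <= dot v (g *m e k) /\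
  (strict v -> dot v (g *m e k) = mul v k -> g *m e k = e k).
Proof.
move=> cv Wg k2 fix_l; have [Q vgQ PQ] := forward vg Wg.
have cQ : curve_class Q (g *m e k) by apply: PQ; apply: exceptional_curve.
case: (EM (exists l, g *m e k = e l)) => [[l lE]|nl].
  have lk : (l <= k)%N.
    rewrite leqNgt; apply/negP => kl; have := dot_exc_image k l Wg.
    rewrite (fix_l l kl) lE dot_e mul_e eqxx => /eqP; rewrite eqr_opp.
    by case: (eqVneq k l) kl => [->|_ _]; rewrite ?ltnn // oner_eq0.
  rewrite lE dot_e; split; first exact: (dominant_sorted cv.1).
  move=> sv mE; congr exc; apply: val_inj; apply/eqP; rewrite eqn_leq lk leqNgt.
  by apply/negP => /(strict_sorted cv.1 sv); rewrite mE ltxx.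
have ne i : g *m e k != e i by apply/eqP => E; case: nl; exists i.
have [||le lt] := exceptional_min cv vgQ cQ _ _ ne.
- by rewrite dot_exc_image // eqxx.
- by rewrite W_dotK // dotC dot_e mul_K.
have m2 : mul v k <= mul v o2 by apply: (dominant_sorted cv.1).
split; first exact: le_trans m2 le.
by move=> /lt h2 E; move: h2; rewrite E ltNge m2.
Qed.

(** Applied to x and g, and to y and the inverse of g, exc_image_min shows that
    x and y have the same multiplicity at k, so that x attains its minimum
    at g e_k. *)
Lemma fix_exc_tail x y g : chamber x -> strict x -> chamber y -> W g -> x = g *m y ->
  forall k, (1 < k)%N -> g *m e k = e k.
Proof.
move=> cx sx cy Wg xE k; have [m] := ubnP (n - k)%N.
elim: m k => // m IHm k mk k2.
have fix_l l : (k < l)%N -> g *m e l = e l.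
  by move=> kl; apply: IHm; have := ltn_ord l; lia.
have Wg1 : W g^-1 by apply: gen_inv.
have fix_l1 l : (k < l)%N -> g^-1 *m e l = e l.
  by move=> kl; rewrite -[in LHS](fix_l _ kl) W_mulVv.
have [lx ex] := exc_image_min cx Wg k2 fix_l.
have [ly _] := exc_image_min cy Wg1 k2 fix_l1.
apply: ex => //; apply/eqP; rewrite eq_le lx andbT.
by rewrite xE W_dot // dot_e -[X in _ <= X]dot_e W_adj.
Qed.

Lemma sum_split2 (E : 'I_n -> R) : (forall l, (1 < l)%N -> E l = 0) ->
  \sum_i E i = E o0 + E o1.
Proof.
move=> E0; rewrite (bigD1 o0) //= (bigD1 o1) //= big1 ?addr0 // => i.
by rewrite -!val_eqE /= => i01; apply: E0; lia.
Qed.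

(** The square (a - b)^2 = 2 (a^2 + b^2) - (a + b)^2 is - (7 d + 1) (d - 1), which
    confines d to 0 and 1. *)
Lemma quadratic_int (d a b : int) : d * d - (a * a + b * b) = -1 -> a + b - 3 * d = -1 ->
  [\/ [/\ d = 0, a = -1 & b = 0], [/\ d = 0, a = 0 & b = -1] | [/\ d = 1, a = 1 & b = 1]].
Proof.
move=> e1 e2; have aE : a = 3 * d - 1 - b by lia.
have sq : (0 <= (a - b) * (a - b))%R by rewrite -expr2 sqr_ge0.
have d01 : d = 0 \/ d = 1.
  have : ((7 * d + 1) * (d - 1) <= 0)%R by rewrite aE in e1 sq; nia.
  by nia.
case: d01 => dE; subst d.
  have : b * (b + 1) = 0 by rewrite aE in e1; nia.
  move/eqP; rewrite mulf_eq0 => /orP[] /eqP bE.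
    by constructor 1; split; lia.
  by constructor 2; split; lia.
have : (b - 1) * (b - 1) = 0 by rewrite aE in e1; nia.
move/eqP; rewrite mulf_eq0 orbb => /eqP bE.
by constructor 3; split; lia.
Qed.

(** An integral class with the numerical invariants of an exceptional curve that is
    orthogonal to all e_l with l > 1 comes from the plane blown up at two
    points, which carries three such curves. *)
Lemma exc_two_points c : integral c -> dot c c = -1 -> dot c K = -1 ->
  (forall l, (1 < l)%N -> mul c l = 0) ->
  [\/ c = e o0, c = e o1 | c = h - e o0 - e o1].
Proof.
move=> [/intrP [d dE] ci] cc cK c0.
have /intrP [a aE] := ci o0; have /intrP [b bE] := ci o1.
have /quadratic_int : d * d - (a * a + b * b) = -1.
  apply: (@intr_inj R); rewrite rmorphB rmorphD /= !rmorphM /= rmorphN1 -dE -aE -bE -cc dotE.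
  by rewrite sum_split2 // => l l1; rewrite c0 // mul0r.
case.
- apply: (@intr_inj R); rewrite rmorphB rmorphD /= rmorphM /= rmorphN1 -dE -aE -bE -cK dot_K.
  by rewrite sum_split2.
all: move=> [d1 a1 b1]; rewrite d1 in dE; rewrite a1 in aE; rewrite b1 in bE.
all: rewrite ?(mulr0z, mulr1z, mulrN1z) in dE aE bE.
all: [> constructor 1 | constructor 2 | constructor 3]; apply: vecP => [|i];
  rewrite ?(degD, degN, deg_h, deg_e, mulD, mulN, mul_h, mul_e) ?dE ?subr0 //.
all: case: (eqVneq i o0) => [->|i0]; first by rewrite aE -?val_eqE /=; lra.
all: case: (eqVneq i o1) => [->|i1]; first by rewrite bE -?val_eqE /=; lra.
all: rewrite c0 ?(eq_sym _ i) ?(negPf i0) ?(negPf i1) ?oppr0 ?addr0 //.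
all: by move: i0 i1; rewrite -!val_eqE /=; lia.
Qed.

(** The line through the two points meets both exceptional curves. *)
Lemma exc_two_points_orth a b :
  [\/ a = e o0, a = e o1 | a = h - e o0 - e o1] ->
  [\/ b = e o0, b = e o1 | b = h - e o0 - e o1] -> dot a b = 0 ->
  (a = e o0 /\ b = e o1) \/ (a = e o1 /\ b = e o0).
Proof.
by case=> ->; case=> ->; rewrite ?(dot_e, dotBr, dot_h)
  ?(mulD, mulN, mul_h, mul_e, degD, degN, deg_h, deg_e) /=;
  try (by left); try (by right); move=> E; exfalso; lra.
Qed.

(** By fix_exc_tail, g can only fix or exchange e_0 and e_1, and x distinguishes
    them. *)
Lemma chamber_free x y g : chamber x -> strict x -> chamber y -> W g -> x = g *m y ->
  g = 1.
Proof.
move=> cx sx cy Wg xE; have tail := fix_exc_tail cx sx cy Wg xE.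
have cls i : (i <= 1)%N -> [\/ g *m e i = e o0, g *m e i = e o1 | g *m e i = h - e o0 - e o1].
  move=> i1; apply: exc_two_points.
  - by apply: W_integral => //; apply: integral_e.
  - by rewrite dot_exc_image // eqxx.
  - by rewrite W_dotK // dotC dot_e mul_K.
  move=> l l1; rewrite -dot_e -{1}(tail l l1) dot_exc_image //.
  by case: eqVneq l1 => [<-|]; rewrite ?oppr0 //; lia.
have orth : dot (g *m e o0) (g *m e o1) = 0 by rewrite dot_exc_image // oppr0.
have y01 : mul y o1 <= mul y o0 by apply: (dominant_sorted cy.1).
have x01 : mul x o1 < mul x o0 by apply: (strict_sorted cx.1 sx).
have yE i : mul y i = dot x (g *m e i) by rewrite -dot_e xE W_dot.
have g01 : g *m e o0 = e o0 /\ g *m e o1 = e o1.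
  have [//|[E0 E1]] := exc_two_points_orth (cls o0 isT) (cls o1 isT) orth.
  by exfalso; move: y01; rewrite !yE E0 E1 !dot_e leNgt x01.
have gexc i : g *m e i = e i.
  have [i1|i1] := ltnP 1 i; first exact: tail.
  have [->|i0] := eqVneq i o0; first by case: g01.
  have -> : i = o1 by apply: val_inj; move: i0; rewrite -val_eqE /=; lia.
  by case: g01.
have gh : g *m h = h.
  have hE : h = 3^-1 *: (\sum_i e i - K).
    rewrite /canonical_class opprD opprK addrCA subrr addr0 scalerA.
    by rewrite mulVf ?scale1r // pnatr_eq0.
  rewrite {1}hE -scalemxAr mulmxBr W_K // mulmx_sumr [RHS]hE; congr (_ *: (_ - _)).
  by apply: eq_bigr => i _.
apply: mx_ext => v; rewrite mul1mx {1}[v]vecE mulmxBr -scalemxAr gh mulmx_sumr [RHS]vecE.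
congr (_ - _); apply: eq_bigr => i _.
by rewrite -scalemxAr gexc.
Qed.

End AtGeneralPoints.
End SimpleTransitivity.

(** * The chamber is a rational polyhedral cone *)

Section HalfSpace.
Variables (R : realType) (m : nat) (I : finType).
Variables (x : I -> 'cV[R]_m) (kappa : I -> R).
Local Notation V := 'cV[R]_m.

Definition halfspace_generators : seq V :=
  [seq x i | i <- [seq i <- enum I | 0 <= kappa i]] ++
  [seq kappa i *: x j - kappa j *: x i |
    i <- [seq i <- enum I | 0 <= kappa i], j <- [seq j <- enum I | kappa j < 0]].

(** The part of a simplicial cone in a half space is generated by the generators
    in the half space and the points where edges between generators on opposite
    sides cross its boundary. *)
Lemma halfspace_cone (a : I -> R) : (forall i, 0 <= a i) -> 0 <= \sum_i a i * kappa i ->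
  cone_hull [set v | v \in halfspace_generators] (\sum_i a i *: x i).
Proof.
move=> a0; set C := cone_hull _; rewrite (bigID (fun i => 0 <= kappa i)) /=.
set Sp := \sum_(i | 0 <= kappa i) _; set Sn := \sum_(i | ~~ _) _ => S0.
have Cx i : 0 <= kappa i -> C (x i).
  move=> ki; apply: cone_hull_mem => /=; rewrite mem_cat map_f //.
  by rewrite mem_filter ki mem_enum.
have Cxx i j : 0 <= kappa i -> kappa j < 0 -> C (kappa i *: x j - kappa j *: x i).
  move=> ki kj; apply: cone_hull_mem => /=; rewrite mem_cat; apply/orP; right.
  apply/allpairsP; exists (i, j); split=> //=; rewrite mem_filter.
    by rewrite ki mem_enum.
  by rewrite kj mem_enum.
have Csum (Q : pred I) (E : I -> V) : (forall i, Q i -> C (E i)) -> C (\sum_(i | Q i) E i).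
  by move=> hE; rewrite big_mkcond; apply: cone_hull_sum => i; case: ifP => [/hE|_] //;
    apply: cone_hull0.
have Sn0 : Sn <= 0.
  rewrite -oppr_ge0 -sumrN; apply: sumr_ge0 => i; rewrite -ltNge => ki.
  by rewrite oppr_ge0; apply: mulr_ge0_le0 => //; apply: ltW.
have Sp0 : 0 <= Sp by apply: sumr_ge0 => i ki; apply: mulr_ge0.
rewrite (bigID (fun i => 0 <= kappa i)) /=.
have [Spz|Spn] := eqVneq Sp 0.
  have an i : ~~ (0 <= kappa i) -> a i = 0.
    move=> ki; have Snz : \sum_(i | ~~ (0 <= kappa i)) - (a i * kappa i) = 0.
      by rewrite sumrN -/Sn; lra.
    have Fn j : ~~ (0 <= kappa j) -> 0 <= - (a j * kappa j).
      by rewrite -ltNge => kj; rewrite oppr_ge0; apply: mulr_ge0_le0 => //; apply: ltW.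
    have /eqP := psumr_eq0P Fn Snz ki; rewrite oppr_eq0 mulf_eq0 => /orP[/eqP //|/eqP k0].
    by rewrite k0 lexx in ki.
  rewrite [X in _ + X]big1 ?addr0 => [|i /an ->]; last by rewrite scale0r.
  by apply: Csum => i ki; apply: cone_hullZ => //; apply: Cx.
have Spp : 0 < Sp by rewrite lt_def Spn Sp0.
(* Each x j beyond the boundary is paired with all x i on this side, in proportion
   to the share of i in Sp. *)
have -> : \sum_(i | 0 <= kappa i) a i *: x i + \sum_(i | ~~ (0 <= kappa i)) a i *: x i =
  \sum_(i | 0 <= kappa i) (a i * (1 + Sn / Sp)) *: x i +
  \sum_(i | 0 <= kappa i) \sum_(j | ~~ (0 <= kappa j))
     (a i * a j / Sp) *: (kappa i *: x j - kappa j *: x i).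
  under [in RHS]eq_bigr => i _ do rewrite mulrDr mulr1 scalerDl.
  rewrite big_split /= -addrA; congr (_ + _).
  under [X in _ = _ + X]eq_bigr => i _ do
    (under eq_bigr => j _ do rewrite scalerBr !scalerA; rewrite sumrB -scaler_suml).
  rewrite sumrB addrCA -sumrB [X in _ = _ + X]big1 ?addr0 => [|i _].
    rewrite exchange_big /=; apply: eq_bigr => j _; rewrite -scaler_suml; congr (_ *: _).
    transitivity (a j / Sp * Sp); first by rewrite divfK.
    by rewrite mulr_sumr; apply: eq_bigr => i _; field.
  rewrite -scalerBl [X in X *: _](_ : _ = 0) ?scale0r //.
  rewrite /Sn mulrA mulrAC mulr_sumr -sumrB big1 // => j _; field.
  exact: Spn.
apply: cone_hullD.
  apply: Csum => i ki; apply: cone_hullZ; last exact: Cx.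
  apply: mulr_ge0 => //; rewrite -(divff Spn) -mulrDl; apply: mulr_ge0.
    exact: S0.
  by rewrite invr_ge0.
apply: (Csum _ _ _) => i ki; apply: Csum => j; rewrite -ltNge => kj.
apply: cone_hullZ; last exact: Cxx.
by rewrite !mulr_ge0 // invr_ge0.
Qed.

End HalfSpace.

Section Rationality.
Variables (R : realType) (m : nat).
Local Notation V := 'cV[R]_m.

Lemma integer_vector (v : V) : (forall a, v a 0 \is a Num.int) ->
  exists z : 'cV[int]_m, v = map_mx intr z.
Proof.
move=> vi; have /choice [z zE] a : exists k : int, v a 0 = k%:~R by apply/intrP.
by exists (\col_a z a); apply/colP => a; rewrite !mxE zE.
Qed.

(** An extremal ray contains each summand of its elements, hence one of the
    generators. *)
Lemma rational_cone (s : seq V) : (forall v, v \in s -> forall a, v a 0 \is a Num.int) ->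
  rational_polyhedral_cone (cone_hull [set v | v \in s]).
Proof.
move=> s_int; split; first by exists s.
move=> v [v0 vC vext].
have vv : ray v v by exists 1; rewrite /= ?ler01 ?scale1r.
have [k [a [x [a0 xs vE]]]] := vC _ vv.
have [i axi] : exists i, a i *: x i != 0.
  apply: contrapT => h; move/eqP: v0; apply; rewrite vE big1 // => i _.
  by apply/eqP; apply: contraPT h => axi; apply; exists i.
have vD : v = a i *: x i + \sum_(j | j != i) a j *: x j.
  by rewrite [LHS]vE (bigD1 i).
have [] := vext (a i *: x i) (\sum_(j | j != i) a j *: x j).
- by apply: cone_hullZ => //; apply: cone_hull_mem; apply: xs.
- rewrite big_mkcond; apply: cone_hull_sum => j; case: ifP => _; last exact: cone_hull0.
  by apply: cone_hullZ => //; apply: cone_hull_mem; apply: xs.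
- by rewrite -vD.
move=> [t /= t0 tE] _; have [z zE] := integer_vector (s_int _ (xs i)).
have ai0 : a i != 0 by apply: contraNneq axi => ->; rewrite scale0r.
exists z.
  by apply: contraNneq axi => z0; rewrite zE z0 map_mx0 scaler0.
exists ((a i)^-1 * t); first by rewrite /= mulr_ge0 // invr_ge0.
by rewrite -scalerA tE scalerA mulVf // scale1r.
Qed.

End Rationality.

Section ChamberGenerators.
Variables (R : realType) (n : nat).
Hypothesis hn : (9 < n)%N.
Local Notation N1 := 'cV[R]_n.+1.
Local Notation dot := (@intersection R n).
Local Notation h := (line_class R n).
Local Notation e := (@exc R n).
Local Notation K := (canonical_class R n).
Local Notation chamber := (@chamber R n hn).
Local Notation dominant := (@dominant R n hn).
Local Notation o0 := (o0 hn).
Local Notation o1 := (o1 hn).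
Local Notation o2 := (o2 hn).
Implicit Types (u v w r c x y : N1) (i j : 'I_n).

Lemma dominantD v w : dominant v -> dominant w -> dominant (v + w).
Proof.
move=> [dv mv] [dw mw]; split=> [r sr|i]; first by rewrite dotDl addr_ge0 ?dv ?dw.
by rewrite mulD addr_ge0.
Qed.

Lemma dominantZ t v : 0 <= t -> dominant v -> dominant (t *: v).
Proof.
move=> t0 [dv mv]; split=> [r sr|i]; first by rewrite dotZl mulr_ge0 ?dv.
by rewrite mulZ mulr_ge0.
Qed.

Lemma chamberD v w : chamber v -> chamber w -> chamber (v + w).
Proof.
move=> [dv vK] [dw wK]; split; first exact: dominantD.
by rewrite dotDl; move: vK wK; lra.
Qed.

Lemma chamberZ t v : 0 <= t -> chamber v -> chamber (t *: v).
Proof.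
move=> t0 [dv vK]; split; first exact: dominantZ.
by rewrite dotZl mulr_ge0_le0.
Qed.

(** The classes h, h - e_0, 2h - e_0 - e_1 and 3h - e_0 - ... - e_(k-1), k > 2: up to
    the order of the coordinates, the dual basis of the simple roots and e_(n-1). *)
Definition fundamental_weight (k : nat) : N1 :=
  (nth 3%N [:: 1%N; 1%N; 2%N] k)%:R *: h - \sum_(i < n) (i < k)%:R *: e i.

Lemma deg_weight k : deg (fundamental_weight k) = (nth 3%N [:: 1%N; 1%N; 2%N] k)%:R.
Proof. exact: deg_comb. Qed.

Lemma mul_weight k i : mul (fundamental_weight k) i = (i < k)%:R.
Proof. exact: mul_comb. Qed.

Lemma weight_integral k : integral (fundamental_weight k).
Proof. by split=> [|i]; rewrite ?deg_weight ?mul_weight natr_int. Qed.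

Lemma weight_dominant k : dominant (fundamental_weight k).
Proof.
split=> [r|i]; last by rewrite mul_weight ler0n.
case=> [->|[i [j [ij ->]]]]; last first.
  by rewrite dot_exc_diff !mul_weight subr_ge0 ler_nat ij; case: ltnP => // /ltnW ->.
rewrite dot_alpha deg_weight !mul_weight -!addrA -!opprD subr_ge0 -!natrD ler_nat.
by case: k => [|[|[|[|k]]]].
Qed.

(** Extended by zero, so that the last coordinate m_(n-1) is a difference like the
    others. *)
Definition mul_nat v (k : nat) : R := oapp (mul v) 0 (@insub _ _ 'I_n k).

Lemma mul_natE v i : mul_nat v i = mul v i.
Proof. by rewrite /mul_nat valK. Qed.

Lemma mul_nat_n v : mul_nat v n = 0.
Proof. by rewrite /mul_nat insubF // ltnn. Qed.

Definition weight_coord v (k : 'I_n.+1) : R :=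
  if k == 0 :> nat then deg v - mul v o0 - mul v o1 - mul v o2
  else mul_nat v k.-1 - mul_nat v k.

Lemma sum_weight_coord (a : R) (m : nat -> R) (i : nat) : (i < n)%N -> m n = 0 ->
  \sum_(k < n.+1) (if k == 0 :> nat then a else m k.-1 - m k) * (i < k)%:R = m i.
Proof.
move=> i_n mn; rewrite big_ord_recl /= mulr0 add0r.
under eq_bigr => k _ do rewrite /bump /= add1n ltnS.
rewrite -(big_mkord xpredT (fun k => (m k - m k.+1) * (i <= k)%:R)).
rewrite (big_cat_nat (n := i)) //=; last exact: ltnW.
rewrite big_nat big1 ?add0r => [|k /andP[_ ki]]; last by rewrite leqNgt ki mulr0.
rewrite big_nat (eq_bigr (fun k => - (m k.+1 - m k))) => [|k /andP[ik _]]; last first.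
  by rewrite ik mulr1 opprB.
by rewrite -big_nat sumrN telescope_sumr ?mn ?sub0r ?opprK // ltnW.
Qed.

Lemma weight_decomposition v :
  v = \sum_k weight_coord v k *: fundamental_weight k.
Proof.
apply: vecP => [|i]; last first.
  rewrite mul_sum; under eq_bigr => k _ do rewrite mulZ mul_weight.
  by rewrite sum_weight_coord ?mul_natE ?mul_nat_n.
rewrite deg_sum; under eq_bigr => k _ do rewrite degZ deg_weight.
pose a := deg v - mul v o0 - mul v o1 - mul v o2.
(* The degree of fundamental_weight k with k > 0 is the number of j < 3 with j < k. *)
transitivity (a + \sum_(j < 3) \sum_(k < n.+1)
    (if k == 0 :> nat then a else mul_nat v k.-1 - mul_nat v k) * (j < k)%:R).
  rewrite (eq_bigr (fun j : 'I_3 => mul_nat v j)) => [|j _]; last first.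
    apply: sum_weight_coord (mul_nat_n v).
    by apply: ltn_trans (ltn_ord j) _; apply: leq_trans hn.
  rewrite !big_ord_recl big_ord0 addr0 /= (mul_natE v o0) (mul_natE v o1) (mul_natE v o2).
  rewrite /a; ring.
rewrite exchange_big /= [in RHS](bigD1 ord0) //= [in LHS](bigD1 ord0) //=.
rewrite big1 ?add0r => [|j _]; last by rewrite mulr0.
rewrite mulr1; congr (_ + _); apply: eq_bigr => k k0.
rewrite -mulr_sumr /weight_coord; congr (_ * _).
rewrite !big_ord_recl big_ord0 addr0 -!natrD; congr _%:R.
by move: k0; rewrite -val_eqE /=; case: (k : nat) => [|[|[|[|k']]]].
Qed.

Lemma weight_coord_ge0 v k : dominant v -> 0 <= weight_coord v k.
Proof.
move=> dv; rewrite /weight_coord; case: eqP => [_|/eqP k0].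
  by have := dominant_deg dv; lra.
have k1n : (k.-1 < n)%N by have := ltn_ord k; lia.
rewrite (mul_natE v (Ordinal k1n)) subr_ge0 /mul_nat.
case: insubP => [i _ ik|_] /=; last exact: dv.2.
by apply: dominant_sorted dv _; rewrite /= ik leq_pred.
Qed.

Definition chamber_generators : seq N1 :=
  halfspace_generators (fun k : 'I_n.+1 => fundamental_weight k)
    (fun k : 'I_n.+1 => - dot (fundamental_weight k) K).

Lemma chamber_generatorsP v : v \in chamber_generators -> integral v /\ chamber v.
Proof.
rewrite /chamber_generators mem_cat => /orP[/mapP [k] | /allpairsP [[k l] /= []]].
  rewrite mem_filter oppr_ge0 => /andP[kK _] ->; split; first exact: weight_integral.
  by split=> //; apply: weight_dominant.
rewrite !mem_filter oppr_ge0 oppr_lt0 => /andP[kK _] /andP[lK _] -> /=.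
have int_kappa (j : nat) : - dot (fundamental_weight j) K \is a Num.int.
  rewrite rpredN; apply: integral_dot; first exact: weight_integral.
  by split=> [|i]; rewrite ?deg_K ?mul_K rpredN ?natr_int ?rpred1.
split.
  have scaled (j j' : nat) :
      integral ((- dot (fundamental_weight j) K) *: fundamental_weight j').
    exact: integral_Z (int_kappa j) (weight_integral j').
  exact: (integral_D (scaled k l) (integral_N (scaled l k))).
split; last by rewrite dotBl !dotZl; lra.
rewrite -scaleNr opprK; apply: dominantD.
  by apply: dominantZ; [rewrite oppr_ge0 | apply: weight_dominant].
by apply: dominantZ; [apply: ltW | apply: weight_dominant].
Qed.

Lemma chamber_cone_hull : chamber = cone_hull [set v | v \in chamber_generators].
Proof.
apply/seteqP; split=> [v cv|]; last first.
  apply: cone_hull_ind => [|v w|c v|v /chamber_generatorsP[]] //.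
  - by rewrite -(scale0r (rho R n)); apply: chamberZ => //; apply: rho_chamber.
  - exact: chamberD.
  - exact: chamberZ.
rewrite [v]weight_decomposition; apply: halfspace_cone.
  by move=> k; apply: weight_coord_ge0; case: cv.
have -> : \sum_k weight_coord v k * - dot (fundamental_weight k) K = - dot v K.
  rewrite [in RHS](weight_decomposition v) dot_suml -sumrN; apply: eq_bigr => k _.
  by rewrite dotZl mulrN.
by rewrite oppr_ge0; case: cv.
Qed.

Lemma integral_entries v a : integral v -> v a 0 \is a Num.int.
Proof.
move=> [vd vm]; case: (unliftP ord0 a) => [i ->|->]; last exact: vd.
by rewrite -[v _ _]opprK rpredN; apply: vm.
Qed.

Lemma chamber_rational : rational_polyhedral_cone chamber.
Proof.
rewrite chamber_cone_hull; apply: rational_cone => v /chamber_generatorsP[vi _] a.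
exact: integral_entries.
Qed.

End ChamberGenerators.

(** * The chamber is a fundamental domain *)

Section Topology.
Variables (R : realType) (n : nat).
Hypothesis hn : (9 < n)%N.
Local Notation N1 := 'cV[R]_n.+1.
Local Notation dot := (@intersection R n).
Local Notation K := (canonical_class R n).
Local Notation W := (@cremona_group R n).
Local Notation simple_root := (@simple_root R n hn).
Local Notation chamber := (@chamber R n hn).
Local Notation rho := (rho R n).
Implicit Types (u v w r : N1) (g : 'M[R]_n.+1).

Lemma continuous_comb (U : normedModType R) (c : 'I_n.+1 -> U) :
  continuous (fun v : N1 => \sum_a v a 0 *: c a).
Proof.
move=> v; apply: (@cvg_big U _ +%R 0 xpredT _ N1 (nbhs v) _ (fun a x => x a 0 *: c a)
  (fun a => v a 0 *: c a) (nbhs_filter v)) => [|a _]; first exact: add_continuous.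
apply: cvgZ; last exact: cvg_cst.
exact: coord_continuous.
Qed.

Lemma continuous_mulmx g : continuous (fun v : N1 => g *m v).
Proof.
have -> : (fun v : N1 => g *m v) = (fun v => \sum_a v a 0 *: col a g).
  apply/funext => v; apply/colP => b; rewrite mxE summxE; apply: eq_bigr => a _.
  by rewrite !mxE mulrC.
exact: continuous_comb.
Qed.

Lemma continuous_dot w : continuous (fun v : N1 => dot v w : R^o).
Proof.
have -> : (fun v : N1 => dot v w : R^o) =
    (fun v => \sum_a v a 0 *: (dot (delta_mx a 0) w : R^o)).
  apply/funext => v; rewrite {1}[v]matrix_sum_delta dot_suml; apply: eq_bigr => a _.
  by rewrite big_ord1 dotZl.
exact: continuous_comb.
Qed.

Lemma continuous_segment v w : continuous (fun t : R => v + t *: w).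
Proof.
move=> t; apply: cvgD; first exact: cvg_cst.
by apply: cvgZ; [exact: cvg_id | exact: cvg_cst].
Qed.

Lemma closed_dot_ge0 w : closed [set v : N1 | 0 <= dot v w].
Proof. exact: (closed_comp (fun v _ => @continuous_dot w v) (@closed_ge R 0)). Qed.

Lemma chamber_closed : closed chamber.
Proof.
have -> : chamber = (\bigcap_(r in [set r | simple_root r]) [set v | 0 <= dot v r]) `&`
   (\bigcap_(i in [set: 'I_n]) [set v | 0 <= dot v (@exc R n i)]) `&`
   [set v | 0 <= dot v (- K)].
  apply/seteqP; split=> v.
    move=> [[vr vm] vK]; split; last by rewrite /= dotNr oppr_ge0.
    by split=> [r sr|i _] /=; [apply: vr | rewrite dot_e].
  move=> [[vr vm] vK]; split; last by move: vK; rewrite /= dotNr oppr_ge0.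
  by split=> [r sr|i]; [apply: vr | rewrite -dot_e; apply: vm].
apply: closedI; last exact: closed_dot_ge0.
by apply: closedI; apply: closed_bigI => r _; apply: closed_dot_ge0.
Qed.

Section FundamentalChamber.
Variable P : 'I_n -> 'cV[R[i]]_3.
Hypotheses (P0 : forall i, P i != 0) (vg : very_general P).
Local Notation T := (Nef_e_Kle0 P).

(** Effectivity is checked on integral generators of the chamber. *)
Lemma W_chamber_sub g v : W g -> chamber v -> T (g *m v).
Proof.
move=> Wg cv; split; last by rewrite W_dotK //; case: cv.
split; first exact: W_chamber_Nef.
move: (cv); rewrite {1}chamber_cone_hull => -[k [a [x [a0 xs ->]]]].
rewrite mulmx_sumr; apply: cone_hull_sum => q; rewrite -scalemxAr.
apply: cone_hullZ => //; have [xi xc] := chamber_generatorsP hn (xs q).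
exact: W_integral_Eff.
Qed.

Lemma chamber_sub : chamber `<=` T.
Proof. by move=> v cv; rewrite -[v]mul1mx; apply: W_chamber_sub => //; apply: gen_one. Qed.

Lemma Nef_e_tiling : T = \bigcup_(g in W) translate_set g chamber.
Proof.
apply/seteqP; split=> v.
  move=> /(Nef_e_chamber hn P0 vg) [g Wg cgv]; exists g^-1; first exact: gen_inv.
  by exists (g *m v) => //; rewrite W_mulVv.
by move=> [g Wg [w cw <-]]; apply: W_chamber_sub.
Qed.

Lemma W_stable g : W g -> translate_set g T = T.
Proof.
have sub g' v : W g' -> T v -> T (g' *m v).
  rewrite {1}Nef_e_tiling => Wg' [g1 Wg1 [w cw <-]].
  by rewrite mulmxA; apply: W_chamber_sub => //; apply: gen_mul.
move=> Wg; apply/seteqP; split=> [_ [v Tv <-]|v Tv]; first exact: sub.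
exists (g^-1 *m v); last by rewrite W_mulvV.
by apply: sub => //; apply: gen_inv.
Qed.

(** A wall of the chamber does not meet its interior: reflecting in the wall the
    segment towards rho gives classes of T outside the chamber. *)
Lemma interior_strict v : chamber v -> interior_in T chamber v -> strict hn v.
Proof.
move=> cv iv r sr; have vr : 0 <= dot v r by case: cv => -[+ _] _; apply.
rewrite lt_def vr andbT; apply/eqP => vr0.
have rv : refl r v = v by rewrite /refl vr0 scale0r addr0.
have [g Wg gE] := simple_refl sr.
pose z (t : R) := v + t *: refl r rho.
have zE t : z t = g *m (v + t *: rho).
  by rewrite gE reflD reflZ rv.
have /(nbhs_subspace_ex _ (chamber_sub cv)) [U Uv UT] :
  nbhs (v : subspace T) chamber by exact: iv.
have : \forall t \near (0 : R), U (z t).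
  have z0 : z 0 = v by rewrite /z scale0r addr0.
  have zc : z t @[t --> (0 : R)] --> z 0 by apply: continuous_segment.
  by apply: zc; rewrite z0.
move=> /nbhs_ballP [eps /= eps0 epsU].
have Uz : U (z (eps / 2)).
  apply: epsU; rewrite /ball /= sub0r normrN ger0_norm.
    by rewrite gtr_pMr // invf_lt1 ?ltr1n.
  by apply/ltW/divr_gt0.
have cz : chamber (z (eps / 2)).
  have Tz : T (z (eps / 2)).
    rewrite zE; apply: W_chamber_sub => //; apply: chamberD => //.
    by apply: chamberZ; [apply/ltW/divr_gt0 | apply: rho_chamber].
  by have : (U `&` T) (z (eps / 2)) by []; rewrite -UT => -[].
have : 0 <= dot (z (eps / 2)) r by case: cz => -[+ _] _; apply.
rewrite /z dotDl dotZl vr0 add0r /refl dotDl dotZl (simple_sq sr).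
have := rho_strict sr; have : 0 < eps / 2 by apply: divr_gt0.
by move: (eps / 2) (dot rho r) => a b; nra.
Qed.

Lemma chamber_fundamental_domain : fundamental_domain W T chamber.
Proof.
have rhoT : T rho by apply: chamber_sub; apply: rho_chamber.
split; [split | split | exact: Nef_e_tiling | ].
- exact: W_stable.
- by move=> g _; apply: continuous_subspaceT; apply: continuous_mulmx.
- move=> g Wg fixT; apply: (@chamber_free _ _ hn P vg rho rho g) => //; try exact: rho_chamber.
    by move=> r; apply: rho_strict.
  by rewrite fixT.
- exact: chamber_sub.
- by apply: closed_subspaceW; apply: chamber_closed.
move=> g Wg g1; rewrite -subset0 => v [iv /interior_subset [w cw wE]].
have cv : chamber v := interior_subset iv.
by move/eqP: g1; apply; apply: (@chamber_free _ _ hn P vg v w g) => //; apply: interior_strict.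
Qed.

End FundamentalChamber.
End Topology.

Theorem theorem1p6 (R : realType) (n : nat) (hn : (9 < n)%N)
    (P : 'I_n -> 'cV[R[i]]_3) (P_neq0 : forall i, P i != 0)
    (hP : very_general P) :
  exists D : set 'cV[R]_n.+1,
    rational_polyhedral_cone D /\
    fundamental_domain (@cremona_group R n) (Nef_e_Kle0 P) D.
Proof.
exists (chamber hn); split; first exact: chamber_rational.
exact: chamber_fundamental_domain.
Qed.
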